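(* Let $\alpha,\beta>0$ and $s,\sigma\in\mathbb{R}$. Then for all sufficiently small $\varepsilon>0$ (that is, there is $\varepsilon_0>0$ such that for every $\varepsilon\in(0,\varepsilon_0)$) there exist an initial datum $\phi\in C^\infty(\mathbb{T})$ with $\|\phi\|_{H^s}<\varepsilon$ and $\operatorname{supp}\widehat\phi\subset\mathbb{N}_0$, a time $T\in(0,\varepsilon)$, and a function $u$ such that the following hold: (i) $u-\widehat\phi(0)\in C([0,T];\mathcal{F}^{-1}\mathcal{X})$. (ii) $u$ is a solution to the Cauchy problem $\partial_tu+iD^\alpha u=uD^\beta u$, $u|_{t=0}=\phi$, on $\mathbb{T}$ in the sense that $$\partial_t\widehat u(t,n)+i|n|^\alpha\widehat u(t,n)=\sum_{\substack{n_1,n_2\in\mathbb{N}_0\\ n_1+n_2=n}}\widehat u(t,n_1)\,|n_2|^\beta\,\widehat u(t,n_2),\qquad \widehat u(0,n)=\widehat\phi(n),$$ for all $t\in[0,T]$ and $n\in\mathbb{N}_0$. (iii) $\|u(T)\|_{H^\sigma}>\varepsilon^{-1}$.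
   Context: $\mathbb{T}=\mathbb{R}/(2\pi\mathbb{Z})$, $\mathbb{N}=\{1,2,\dots\}$, $\mathbb{N}_0=\mathbb{N}\cup\{0\}$. Fourier coefficients are normalized as $\widehat f(n)=\frac1{2\pi}\int_{\mathbb{T}}f(x)e^{-inx}\,dx$, so that $f=\sum_n\widehat f(n)e^{inx}$, and correspondingly $\mathcal{F}f(\xi)=\widehat f(\xi)=\frac1{2\pi}\int_{\mathbb{R}}f(x)e^{-ix\xi}dx$ on $\mathbb{R}$, so that $\mathcal{F}[e^{inx}]=\delta_n$ (Dirac measure at $n$). $D^\alpha=\mathcal{F}^{-1}|\xi|^\alpha\mathcal{F}$. $\langle n\rangle=(1+n^2)^{1/2}$ and $\|f\|_{H^s}=\|\langle n\rangle^s\widehat f(n)\|_{\ell^2_n}$ (up to an immaterial fixed constant), with value $+\infty$ if the sum diverges. Here $u(t)$ is a (generalized) $2\pi$-periodic function with nonnegative frequencies, $u(t)=\sum_{n\in\mathbb{N}_0}\widehat u(t,n)e^{inx}$, understood as the element of $\mathcal{F}^{-1}\mathcal{D}'(\mathbb{R})$ whose Fourier transform is $\sum_{n\in\mathbb{N}_0}\widehat u(t,n)\delta_n$; the number $\widehat\phi(0)$ in (i) is regarded as a constant function of $x$. The space $\mathcal{X}$. $\mathcal{D}(\mathbb{R})$ is the space of smooth compactly supported functions. $\mathcal{X}$ is the space of $F\in\mathcal{D}'(\mathbb{R})$ for which there exist $a\in(0,\infty)$ and a $\mathbb{C}$-valued Borel measure $\mathfrak{m}$ on $\mathbb{R}$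 such that $F=\mathfrak{m}$ on $(-\infty,a)$ and $|\mathfrak{m}|((-\infty,0])=0$, where $|\mathfrak m|$ is the total variation. Equivalently, let $C^{\nearrow}$ be the set of continuous non-decreasing $f:[0,\infty)\to[0,\infty)$; for $\delta>0$ let $C^{\nearrow}_\delta=\{f\in C^{\nearrow}: f(0)=0,\ f([0,2\delta])\subset[0,\frac12]\}$, and $C_0^{\nearrow}=\bigcup_{\delta\in(0,1]}C_\delta^{\nearrow}$. Let $\|\psi\|_m^+=\max_{n\in\mathbb{N}_0,\,n\le m}\sup_{\xi\ge0}|\partial^n\psi(\xi)|$, $\mathcal{D}_{<l}=\{\psi\in\mathcal{D}(\mathbb{R}):\operatorname{supp}\psi\subset(-\infty,l)\}$, $\rho_l^m(F)=\sup\{\operatorname{Re}\langle F,\psi\rangle:\psi\in\mathcal{D}_{<l},\ \|\psi\|_m^+\le1\}$, $\rho_l^{\mu,\nu}(F)=\inf\{B\ge0:\ \rho_t^{\mu(t)}(F)\le B\nu(t)\ \text{for all }0<t\le l\}$, $\rho^{\mu,\nu}(F)=\sup_{l>0}\rho_l^{\mu,\nu}(F)$, and let $\mathcal{X}^{\mu,\nu}=\{F\in\mathcal{D}'(\mathbb{R}):\rho^{\mu,\nu}(F)<\infty\}$ (a Banach space). Then $\mathcal{X}=\bigcup_{\mu,\nu\in C_0^{\nearrow}}\mathcal{X}^{\mu,\nu}$, endowed with the inductive limit topology of locally convex spaces. $\mathcal{F}^{-1}\mathcal{D}'(\mathbb{R})$ is the dual of $\mathcal{F}\mathcal{D}(\mathbb{R})=\{\widehat\psi:\psi\in\mathcal{D}(\mathbb{R})\}$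 (topology transported from $\mathcal{D}(\mathbb{R})$ by $\mathcal{F}$), with $\langle\mathcal{F}F,\psi\rangle:=\langle F,\widehat\psi\rangle$; $\mathcal{F}^{-1}\mathcal{X}=\{F\in\mathcal{F}^{-1}\mathcal{D}'(\mathbb{R}):\widehat F\in\mathcal{X}\}$ with the topology transported by $\mathcal{F}^{-1}$. *)

(* Defs.v *)
From HB Require Import structures.
From mathcomp Require Import all_boot all_order all_algebra.
From mathcomp Require Import all_classical all_reals all_analysis.
From mathcomp Require Import measurable_realfun complex.
Set Implicit Arguments.
Unset Strict Implicit.
Unset Printing Implicit Defensive.
Import Order.TTheory GRing.Theory Num.Theory.
Import numFieldNormedType.Exports.
Import ComplexField.Normc.

Local Open Scope classical_set_scope.
Local Open Scope ring_scope.
Local Open Scope complex_scope.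

Section Defs.
Context {R : realType}.
Local Notation C := R[i].
Local Notation leb := (@lebesgue_measure R).
Local Notation Re := (@complex.Re R).
Local Notation Im := (@complex.Im R).

(* Smoothness and derivatives of complex-valued functions of a real variable
   are taken componentwise. *)
Definition smooth_real (f : R -> R) : Prop :=
  forall n x, derivable (derive1n n f) x 1.

Definition smooth (f : R -> C) : Prop :=
  smooth_real (Re \o f) /\ smooth_real (Im \o f).

Definition cderiv (n : nat) (f : R -> C) (x : R) : C :=
  derive1n n (Re \o f) x +i* derive1n n (Im \o f) x.

Definition tsupp (f : R -> C) : set R := closure [set x | f x != 0].

Definition cintegral (D : set R) (f : R -> C) : C :=
  (\int[leb]_(x in D) Re (f x)) +i* (\int[leb]_(x in D) Im (f x)).

Definition expi (x : R) : C := cos x +i* sin x.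

(* Normalized so that, with the dual transform [fourierT] below, e^{inx} is sent
   to the Dirac mass at n. *)
Definition fourier (f : R -> C) (xi : R) : C :=
  (2 * pi)^-1%:C * cintegral setT (fun x => f x * expi (- (x * xi))).

Lemma derive1n_lin (a b : R) (f g : R -> R) n :
  smooth_real f -> smooth_real g ->
  derive1n n (fun x => a * f x + b * g x) =
    (fun x => a * derive1n n f x + b * derive1n n g x).
Proof.
move=> sf sg; elim: n => [//|n IH]; apply/funext => x.
rewrite [LHS]/= IH derive1E.
rewrite (@deriveD R R R (a \*: derive1n n f) (b \*: derive1n n g)); last 2 first.
- exact: derivableZ (sf n x).
- exact: derivableZ (sg n x).
rewrite deriveZ; last exact: sf.
by rewrite deriveZ; [rewrite -!derive1E | exact: sg].
Qed.

Lemma smooth_real_lin (a b : R) (f g : R -> R) :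
  smooth_real f -> smooth_real g -> smooth_real (fun x => a * f x + b * g x).
Proof.
move=> sf sg n x; rewrite (derive1n_lin a b n sf sg).
by apply: derivableD; [exact: derivableZ (sf n x)|exact: derivableZ (sg n x)].
Qed.

Arguments derive1n_lin a b {f g} n _ _.
Arguments smooth_real_lin a b {f g} _ _.

Lemma ReM (a b : C) : Re (a * b) = Re a * Re b - Im a * Im b.
Proof. by case: a b => [? ?] [? ?]. Qed.
Lemma ImM (a b : C) : Im (a * b) = Im a * Re b + Re a * Im b.
Proof. by case: a b => [? ?] [? ?] /=; rewrite addrC. Qed.
Lemma ReD (a b : C) : Re (a + b) = Re a + Re b.
Proof. by case: a b => [? ?] [? ?]. Qed.
Lemma ImD (a b : C) : Im (a + b) = Im a + Im b.
Proof. by case: a b => [? ?] [? ?]. Qed.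

Lemma derivable1n_cont (f : R -> R) : smooth_real f -> continuous f.
Proof.
move=> sf x; apply: differentiable_continuous.
by apply/derivable1_diffP; exact: (sf 0%N).
Qed.

Lemma reim_lin (a : C) (f g : R -> C) :
  (Re \o (fun x => a * f x + g x) =
     (fun x => 1 * (Re a * (Re \o f) x + - Im a * (Im \o f) x)
               + 1 * (Re \o g) x)) /\
  (Im \o (fun x => a * f x + g x) =
     (fun x => 1 * (Im a * (Re \o f) x + Re a * (Im \o f) x)
               + 1 * (Im \o g) x)).
Proof.
split; apply/funext => x /=.
  by rewrite ReD ReM !mul1r mulNr.
by rewrite ImD ImM !mul1r.
Qed.

Lemma smooth_lin (a : C) (f g : R -> C) :
  smooth f -> smooth g -> smooth (fun x => a * f x + g x).
Proof.
move=> [f1 f2] [g1 g2]; have [E1 E2] := reim_lin a f g.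
by split; rewrite ?E1 ?E2; (apply: smooth_real_lin; [exact: smooth_real_lin|]).
Qed.

Lemma cderiv_lin (a : C) (f g : R -> C) n x : smooth f -> smooth g ->
  cderiv n (fun x => a * f x + g x) x = a * cderiv n f x + cderiv n g x.
Proof.
move=> [f1 f2] [g1 g2]; have [E1 E2] := reim_lin a f g.
rewrite /cderiv E1 E2.
rewrite (derive1n_lin 1 1 n (smooth_real_lin _ _ f1 f2) g1).
rewrite (derive1n_lin 1 1 n (smooth_real_lin _ _ f1 f2) g2).
rewrite (derive1n_lin _ _ n f1 f2) (derive1n_lin _ _ n f1 f2).
case: a {E1 E2} => a b /=; rewrite !mul1r mulNr; congr (_ +i* _).
by rewrite [b * _ + _]addrC.
Qed.

Lemma normc_ge0 (z : C) : 0 <= normc z.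
Proof. by case: z => a b; exact: sqrtr_ge0. Qed.

Lemma smooth0 : smooth (fun=> 0).
Proof.
have E n : derive1n n (fun=> 0 : R) = (fun=> 0).
  by elim: n => [//|n IH] /=; rewrite IH; apply/funext => x; rewrite derive1_cst.
by split=> n x; rewrite /comp /= E; exact: derivable_cst.
Qed.

Lemma tsupp0 : tsupp (fun=> 0) = set0.
Proof.
rewrite /tsupp (_ : [set x | _] = set0) ?closure0//.
by apply/seteqP; split => x //=; rewrite eqxx.
Qed.

Lemma tsupp_lin (a : C) (f g : R -> C) :
  tsupp (fun x => a * f x + g x) `<=` tsupp f `|` tsupp g.
Proof.
rewrite /tsupp -closureU; apply: closure_subset => x /= h.
have [f0|] := eqVneq (f x) 0; last by left.
by right; move: h; rewrite f0 mulr0 add0r.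
Qed.

(* D(R) *)
Definition test_pred : {pred R -> C^o} :=
  mem [set f : R -> C^o | smooth f /\ compact (tsupp f)].

Lemma test_submod : submod_closed test_pred.
Proof.
split=> [|a f g].
  rewrite inE /=; split; first exact: smooth0.
  by rewrite tsupp0; exact: compact0.
rewrite !inE /= => -[sf cf] [sg cg]; split; first exact: smooth_lin.
apply: (subclosed_compact _ (compactU cf cg)); last exact: tsupp_lin.
exact: closed_closure.
Qed.

HB.instance Definition _ :=
  GRing.isSubmodClosed.Build C (R -> C^o) test_pred test_submod.

Record testfun := TestFun {
  testfun_val :> R -> C^o ; _ : testfun_val \in test_pred }.

HB.instance Definition _ := [isSub for testfun_val].
HB.instance Definition _ := [Choice of testfun by <:].
HB.instance Definition _ := [SubChoice_isSubLmodule of testfun by <:].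

Lemma testfunP (f : testfun) : smooth f /\ compact (tsupp f).
Proof. by have := valP f; rewrite inE. Qed.

Lemma testfun_lin (a : C) (f g : testfun) :
  (a *: f + g : testfun) = (fun x => a * f x + g x) :> (R -> C).
Proof. by []. Qed.

Lemma compact_supp_integrable (f : testfun) (h k : R -> R) :
  continuous h -> continuous k ->
  leb.-integrable setT
    (EFin \o (fun x => Re (f x) * h x + Im (f x) * k x)).
Proof.
move=> ch ck; have [[s1 s2] cf] := testfunP f.
set F := fun x => _.
have cF : continuous F.
  move=> x; apply: cvgD; apply: cvgM; try exact: ch; try exact: ck.
    exact: (derivable1n_cont s1).
  exact: (derivable1n_cont s2).
have mK : measurable (tsupp f) by apply: compact_measurable.
have iF : leb.-integrable (tsupp f) (EFin \o F).
  apply: continuous_compact_integrable => //.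
  exact: continuous_subspaceT.
have := (integrable_mkcond (mu := leb) (EFin \o F) mK).1 iF.
congr (_.-integrable _ _); apply/funext => x; rewrite patchE.
case: ifPn => // /negP; rewrite inE => nK.
have f0 : f x = 0.
  by apply: contrapT => /eqP fx; apply: nK; exact: subset_closure.
by rewrite /= /F f0 /= !mul0r addr0.
Qed.

Definition cintegrable (F : R -> C) := leb.-integrable setT (EFin \o (Re \o F)) /\
  leb.-integrable setT (EFin \o (Im \o F)).

Lemma cintegral_lin (a : C) (F G : R -> C) : cintegrable F -> cintegrable G ->
  cintegral setT (fun x => a * F x + G x) =
    a * cintegral setT F + cintegral setT G.
Proof.
have iZ (c : R) (h : R -> R) : leb.-integrable setT (EFin \o h) ->
    leb.-integrable setT (EFin \o (fun x => c * h x)).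
  by move=> /(integrableZl measurableT c).
have iD (h1 h2 : R -> R) : leb.-integrable setT (EFin \o h1) ->
    leb.-integrable setT (EFin \o h2) ->
    leb.-integrable setT (EFin \o (fun x => h1 x + h2 x)).
  by move=> i1 i2; exact: (integrableD measurableT i1 i2).
have L3 (c d : R) (h1 h2 h3 : R -> R) : leb.-integrable setT (EFin \o h1) ->
    leb.-integrable setT (EFin \o h2) -> leb.-integrable setT (EFin \o h3) ->
    \int[leb]_(x in setT) (c * h1 x + d * h2 x + h3 x) =
    c * \int[leb]_(x in setT) h1 x + d * \int[leb]_(x in setT) h2 x +
    \int[leb]_(x in setT) h3 x.
  move=> i1 i2 i3; rewrite (RintegralD measurableT (iD _ _ (iZ c _ i1) (iZ d _ i2)) i3).
  rewrite (RintegralD measurableT (iZ c _ i1) (iZ d _ i2)).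
  by rewrite !RintegralZl.
move=> [iF1 iF2] [iG1 iG2]; rewrite /cintegral; case: a => a b.
have -> : (fun x => complex.Re ((a +i* b) * F x + G x)) =
    (fun x => a * (Re \o F) x + (- b) * (Im \o F) x + (Re \o G) x).
  by apply/funext => x; rewrite ReD ReM /= mulNr.
have -> : (fun x => complex.Im ((a +i* b) * F x + G x)) =
    (fun x => b * (Re \o F) x + a * (Im \o F) x + (Im \o G) x).
  by apply/funext => x; rewrite ImD ImM.
rewrite (L3 _ _ _ _ _ iF1 iF2 iG1) (L3 _ _ _ _ _ iF1 iF2 iG2) mulNr.
rewrite [b * _ + _]addrC.
by [].
Qed.

Lemma fourier_integrable (f : testfun) (xi : R) :
  cintegrable (fun x => f x * expi (- (x * xi))).
Proof.
have cc : continuous (fun x : R => - (x * xi)).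
  by move=> x; apply: cvgN; apply: cvgM; [exact: cvg_id|exact: cvg_cst].
have c1 : continuous (fun x : R => cos (- (x * xi))).
  by move=> x; apply: continuous_comp; [exact: cc|exact: continuous_cos].
have c2 : continuous (fun x : R => sin (- (x * xi))).
  by move=> x; apply: continuous_comp; [exact: cc|exact: continuous_sin].
have c3 : continuous (fun x : R => - sin (- (x * xi))).
  by move=> x; apply: cvgN; exact: c2.
split.
- have := compact_supp_integrable f c1 c3.
  congr (_.-integrable _ (EFin \o _)); apply/funext => x /=.
  by rewrite ReM /= mulrN.
- have := compact_supp_integrable f c2 c1.
  congr (_.-integrable _ (EFin \o _)); apply/funext => x /=.
  by rewrite ImM /= addrC.
Qed.

Lemma fourier_lin (a : C) (f g : testfun) :
  fourier (a *: f + g : testfun) = (fun xi => a * fourier f xi + fourier g xi).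
Proof.
apply/funext => xi; rewrite /fourier mulrCA -mulrDr; congr (_ * _).
rewrite -cintegral_lin; [|exact: fourier_integrable..].
by congr cintegral; apply/funext => x; rewrite testfun_lin mulrDl mulrA.
Qed.

Lemma fourier0 : fourier (0 : testfun) = (fun=> 0).
Proof.
have := fourier_lin (-1) 0 0.
rewrite scaleN1r addNr => /= E; apply/funext => xi.
by rewrite E mulN1r addNr.
Qed.

(* FD(R), the Fourier transforms of test functions *)
Definition ftest_pred : {pred R -> C^o} :=
  mem [set g : R -> C^o | exists psi : testfun, g = fourier psi].

Lemma ftest_submod : submod_closed ftest_pred.
Proof.
split=> [|a f g].
  by rewrite inE /=; exists 0; rewrite fourier0.
rewrite !inE /= => -[phi ->] [psi ->]; exists (a *: phi + psi).
by rewrite fourier_lin.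
Qed.

HB.instance Definition _ :=
  GRing.isSubmodClosed.Build C (R -> C^o) ftest_pred ftest_submod.

Record ftest := FTest { ftest_val :> R -> C^o ; _ : ftest_val \in ftest_pred }.

HB.instance Definition _ := [isSub for ftest_val].
HB.instance Definition _ := [Choice of ftest by <:].
HB.instance Definition _ := [SubChoice_isSubLmodule of ftest by <:].

Lemma fourier_ftest (psi : testfun) : (fourier psi : R -> C^o) \in ftest_pred.
Proof. by rewrite inE; exists psi. Qed.

Definition fourierD (psi : testfun) : ftest := FTest (fourier_ftest psi).

Lemma fourierD_linear (a : C) (f g : testfun) :
  fourierD (a *: f + g) = a *: fourierD f + fourierD g.
Proof. by apply: val_inj; rewrite /= fourier_lin. Qed.


Definition sup_deriv (n : nat) (D : set R) (f : R -> C) : \bar R :=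
  ereal_sup [set (normc (cderiv n f x))%:E | x in D].

Lemma sup_deriv_ge0 n (x : R) D f : D x -> (0 <= sup_deriv n D f)%E.
Proof.
move=> Dx; apply: le_ereal_sup_tmp.
exists (normc (cderiv n f x))%:E; first by exists x.
by rewrite lee_fin normc_ge0.
Qed.

Lemma sup_deriv_lin n (x : R) (D : set R) (a : C) (f g : testfun) : D x ->
  (sup_deriv n D (a *: f + g : testfun)%R <=
   (normc a)%:E * sup_deriv n D f + sup_deriv n D g)%E.
Proof.
move=> Dx; apply: ge_ereal_sup => _ [y Dy <-].
have [sf _] := testfunP f; have [sg _] := testfunP g.
rewrite testfun_lin (cderiv_lin a n y sf sg).
apply: (@le_trans _ _ ((normc a)%:E * (normc (cderiv n f y))%:E +
    (normc (cderiv n g y))%:E)%E).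
  by rewrite -EFinM -EFinD lee_fin -normcM le_normcD.
apply: leeD; last by apply: ereal_sup_ubound; exists y.
by rewrite lee_wpmul2l ?lee_fin ?normc_ge0//; apply: ereal_sup_ubound; exists y.
Qed.

Lemma linear_comb (U : lmodType C) (a : C) (F G : U -> C^o) :
  linear F -> linear G -> linear (a *: F + G).
Proof.
move=> lF lG b x y.
have E z : (a *: F + G) z = a *: F z + G z by [].
rewrite !E lF lG !scalerDr !scalerA [b * a]mulrC -!addrA; congr (_ + _).
by rewrite addrCA.
Qed.

(* D'(R); continuity on D(R) is the usual seminorm estimate on each compact set *)
Definition dist_pred : {pred testfun -> C^o} :=
  mem [set F : testfun -> C^o | linear F /\
    forall K : set R, compact K -> exists (m : nat) (c : R), 0 <= c /\
      forall psi : testfun, tsupp psi `<=` K ->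
        ((normc (F psi))%:E <= c%:E * \sum_(j < m.+1) sup_deriv j setT psi)%E].

Lemma dist_submod : submod_closed dist_pred.
Proof.
have incr (m n : nat) (psi : R -> C) : (m <= n)%N ->
    (\sum_(j < m.+1) sup_deriv j setT psi <= \sum_(j < n.+1) sup_deriv j setT psi)%E.
  move=> mn; rewrite -!(big_mkord xpredT (fun j => sup_deriv j setT psi)).
  rewrite [leRHS](@big_cat_nat _ _ _ m.+1)//= leeDl// sume_ge0// => j _.
  exact: (@sup_deriv_ge0 _ 0).
have pos (m : nat) (psi : R -> C) : (0 <= \sum_(j < m.+1) sup_deriv j setT psi)%E.
  by apply: sume_ge0 => j _; exact: (@sup_deriv_ge0 _ 0).
split=> [|a F G].
  rewrite inE /=; split; first by move=> b x y /=; rewrite scaler0 addr0.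
  move=> K _; exists 0%N, 0; split=> // psi _.
  by rewrite mul0e lee_fin expr0n/= addr0 sqrtr0.
rewrite !inE /= => -[lF bF] [lG bG]; split; first exact: linear_comb.
move=> K cK; have [m1 [c1 [c10 b1]]] := bF K cK; have [m2 [c2 [c20 b2]]] := bG K cK.
exists (maxn m1 m2), (normc a * c1 + c2); split.
  by rewrite addr_ge0// mulr_ge0// normc_ge0.
move=> psi sK.
apply: (@le_trans _ _ ((normc a)%:E * (normc (F psi))%:E + (normc (G psi))%:E)%E).
  by rewrite -EFinM -EFinD lee_fin -normcM le_normcD.
rewrite EFinD ge0_muleDl ?lee_fin ?mulr_ge0 ?normc_ge0// EFinM -muleA.
apply: leeD.
  rewrite lee_wpmul2l ?lee_fin ?normc_ge0//; apply: le_trans (b1 _ sK) _.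
  by rewrite lee_wpmul2l ?lee_fin//; apply: incr; exact: leq_maxl.
apply: le_trans (b2 _ sK) _.
by rewrite lee_wpmul2l ?lee_fin//; apply: incr; exact: leq_maxr.
Qed.

HB.instance Definition _ :=
  GRing.isSubmodClosed.Build C (testfun -> C^o) dist_pred dist_submod.

Record dist := Dist { dist_val :> testfun -> C^o ; _ : dist_val \in dist_pred }.

HB.instance Definition _ := [isSub for dist_val].
HB.instance Definition _ := [Choice of dist by <:].
HB.instance Definition _ := [SubChoice_isSubLmodule of dist by <:].

Lemma distP (F : dist) : linear F.
Proof. by have := valP F; rewrite inE => -[]. Qed.

(* F^{-1}D'(R), the dual of FD(R). The topology of FD(R) is transported from D(R),
   so F is continuous iff its composition with [fourierD] is. *)
Definition fdist_pred : {pred ftest -> C^o} :=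
  mem [set F : ftest -> C^o | linear F /\ (F \o fourierD) \in dist_pred].

Lemma fdist_submod : submod_closed fdist_pred.
Proof.
split=> [|a F G].
  rewrite inE /=; split; first by move=> b x y /=; rewrite scaler0 addr0.
  exact: (rpred0 dist_pred).
rewrite !inE /= => -[lF dF] [lG dG]; split; first exact: linear_comb.
exact: (rpredD (rpredZ a dF) dG).
Qed.

HB.instance Definition _ :=
  GRing.isSubmodClosed.Build C (ftest -> C^o) fdist_pred fdist_submod.

Record fdist := FDist { fdist_val :> ftest -> C^o ; _ : fdist_val \in fdist_pred }.

HB.instance Definition _ := [isSub for fdist_val].
HB.instance Definition _ := [Choice of fdist by <:].
HB.instance Definition _ := [SubChoice_isSubLmodule of fdist by <:].

Lemma fourierT_subproof (F : fdist) : (F \o fourierD) \in dist_pred.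
Proof. by have := valP F; rewrite inE => -[]. Qed.

(* <fourierT F, psi> = <F, fourier psi> *)
Definition fourierT (F : fdist) : dist := Dist (fourierT_subproof F).


(* Elements of C^{nearrow} are represented by functions on the whole line of which
   only the values on [0, +oo[ matter. *)
Definition Cup (f : R -> R) : Prop :=
  [/\ {within `[0, +oo[, continuous f},
      {in `[0, +oo[ &, {homo f : x y / x <= y}} &
      forall x, 0 <= x -> 0 <= f x].

Definition Cup_delta (delta : R) (f : R -> R) : Prop :=
  [/\ Cup f, f 0 = 0 & forall x, 0 <= x <= 2 * delta -> 0 <= f x <= 2^-1].

Definition Cup0 (f : R -> R) : Prop :=
  exists2 delta, 0 < delta <= 1 & Cup_delta delta f.

(* The order m is real since it is later instantiated with mu(t). *)
Definition norm_plus (m : R) (psi : R -> C) : \bar R :=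
  ereal_sup [set sup_deriv n [set xi | 0 <= xi] psi | n in [set n | n%:R <= m]].

Definition rho (l m : R) (F : dist) : \bar R :=
  ereal_sup [set (Re (F psi))%:E | psi in
    [set psi : testfun |
      tsupp psi `<=` [set xi | xi < l] /\ (norm_plus m psi <= 1)%E]].

Definition rho_upto (mu nu : R -> R) (l : R) (F : dist) : \bar R :=
  ereal_inf [set B%:E | B in
    [set B : R | 0 <= B /\
      forall t, 0 < t <= l -> (rho t (mu t) F <= (B * nu t)%:E)%E]].

Definition rhoX (mu nu : R -> R) (F : dist) : \bar R :=
  ereal_sup [set rho_upto mu nu l F | l in [set l | 0 < l]].

(* X as the union of the spaces X^{mu,nu} *)
Definition X_pred : {pred dist} := mem [set F : dist |
  exists mu nu, [/\ Cup0 mu, Cup0 nu & (rhoX mu nu F < +oo)%E]].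

Lemma Cup0_max (f g : R -> R) : Cup0 f -> Cup0 g -> Cup0 (f \max g).
Proof.
move=> [d1 /andP[d10 d11] [[c1 h1 p1] z1 b1]].
move=> [d2 /andP[d20 d21] [[c2 h2 p2] z2 b2]].
exists (Order.min d1 d2); first by rewrite lt_min d10 d20 ge_min d11.
split; first split.
- by move=> x; apply: continuous_max; [exact: c1|exact: c2].
- move=> x y x0 y0 xy /=.
  by rewrite ge_max !le_max (h1 x y)// (h2 x y)// orbT.
- by move=> x x0 /=; rewrite le_max p1.
- by rewrite /= z1 z2 maxxx.
- move=> x /andP[x0 xd] /=.
  have /andP[? ?] : 0 <= f x <= 2^-1.
    by apply: b1; rewrite x0 (le_trans xd)// ler_pM2l// ge_min lexx.
  have /andP[? ?] : 0 <= g x <= 2^-1.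
    by apply: b2; rewrite x0 (le_trans xd)// ler_pM2l// ge_min lexx orbT.
  by rewrite le_max ge_max; apply/andP; split; [apply/orP; left|apply/andP].
Qed.

Lemma norm_plus_incr (m m' : R) (psi : R -> C) : m <= m' ->
  (norm_plus m psi <= norm_plus m' psi)%E.
Proof.
move=> mm; apply: ereal_sup_le => _ [n /= nm <-]; exists n => //=.
exact: le_trans mm.
Qed.

Lemma sup_deriv0 n (D : set R) (x : R) : D x ->
  sup_deriv n D (0 : testfun) = 0%E.
Proof.
move=> Dx; have E y : cderiv n (0 : testfun) y = 0.
  have := cderiv_lin (-1) n y smooth0 smooth0.
  rewrite [in RHS]mulN1r [in RHS]addNr => H; apply: (etrans _ H); congr (cderiv n _ y).
  by apply/funext => z; rewrite mulr0 addr0.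
apply/eqP; rewrite eq_le (sup_deriv_ge0 _ _ Dx) andbT.
by apply: ge_ereal_sup => _ [y Dy <-]; rewrite E lee_fin (normc0 R).
Qed.

Lemma norm_plusZ (m : R) (a : C) (psi : testfun) :
  (norm_plus m (a *: psi : testfun)%R <= (normc a)%:E * norm_plus m psi)%E.
Proof.
apply: ge_ereal_sup => _ [n /= nm <-].
have D0 : [set xi : R | 0 <= xi] 0 by rewrite /=.
have := sup_deriv_lin n a psi 0 D0.
rewrite addr0 (sup_deriv0 n D0) adde0 => /le_trans; apply.
rewrite lee_wpmul2l ?lee_fin ?normc_ge0//.
by apply: ereal_sup_ubound; exists n.
Qed.

Lemma rho_incr (l m m' : R) (F : dist) : m <= m' -> (rho l m' F <= rho l m F)%E.
Proof.
move=> mm; apply: ereal_sup_le => _ [psi [s1 n1] <-]; exists psi => //; split=> //.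
by apply: le_trans n1; exact: norm_plus_incr.
Qed.

Lemma rho_lin (l m : R) (a : C) (F G : dist) :
  (rho l m (a *: F + G)%R <= (normc a)%:E * rho l m F + rho l m G)%E.
Proof.
apply: ge_ereal_sup => _ [psi [s1 n1] <-].
have -> : (a *: F + G) psi = a * F psi + G psi by [].
rewrite ReD EFinD; apply: leeD; last by apply: ereal_sup_ubound; exists psi.
have [->|a0] := eqVneq a 0; first by rewrite mul0r (normc0 R) mul0e.
have na0 : normc a != 0 by apply: contra a0 => /eqP/eq0_normc ->.
pose b : C := a / (normc a)%:C.
have nC : normc (normc a)%:C = normc a.
  by rewrite /normc /= expr0n /= addr0 sqrtr_sqr ger0_norm// normc_ge0.
have nb : normc b = 1.
  by rewrite normcM normcV nC mulfV.
have -> : Re (a * F psi) = normc a * Re (F (b *: psi)).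
  have -> : F (b *: psi) = b * F psi.
    have := distP F b psi 0; rewrite addr0 => ->.
    have := distP F (-1) 0 0; rewrite scaleN1r !addNr scaleN1r addNr => ->.
    by rewrite addr0.
  have ab : a = (normc a)%:C * b.
    rewrite /b mulrCA mulfV ?mulr1//; apply/eqP => /(congr1 Re) /= E.
    by rewrite E eqxx in na0.
  by rewrite {1}ab -mulrA ReM /= mul0r subr0.
rewrite EFinM lee_wpmul2l ?lee_fin ?normc_ge0//.
apply: ereal_sup_ubound; exists (b *: psi) => //; split.
  have := @tsupp_lin b psi (0 : testfun).
  rewrite -testfun_lin addr0 tsupp0 setU0 => H.
  exact: subset_trans H s1.
by apply: le_trans (norm_plusZ _ _ _) _; rewrite nb mul1e.
Qed.


Lemma rhoX_fin (mu nu : R -> R) (F : dist) : Cup0 nu ->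
  (rhoX mu nu F < +oo)%E <->
  exists2 B, 0 <= B & forall t, 0 < t -> (rho t (mu t) F <= (B * nu t)%:E)%E.
Proof.
move=> [d _ [[_ _ nu0] _ _]]; split=> [h|[B B0 hB]]; last first.
  apply: (@le_lt_trans _ _ B%:E); last exact: ltry.
  apply: ge_ereal_sup => _ [l l0 <-]; apply: ereal_inf_lbound; exists B => //.
  by split=> // t /andP[t0 _]; exact: hB.
have ge0 l : (0 <= rho_upto mu nu l F)%E.
  by apply: le_ereal_inf_tmp => _ [B [B0 _] <-]; rewrite lee_fin.
have rX0 : (0 <= rhoX mu nu F)%E.
  apply: le_ereal_sup_tmp; exists (rho_upto mu nu 1 F) => //.
  by exists 1 => //=; exact: ltr01.
have fX : rhoX mu nu F \is a fin_num by rewrite ge0_fin_numE.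
exists (fine (rhoX mu nu F) + 1); first by rewrite addr_ge0// fine_ge0.
move=> t t0.
have : (rho_upto mu nu t F < (fine (rhoX mu nu F) + 1)%:E)%E.
  apply: (@le_lt_trans _ _ (rhoX mu nu F)).
    by apply: ereal_sup_ubound; exists t.
  by rewrite -{1}(fineK fX) lte_fin ltrDl ltr01.
move=> /ereal_inf_ltP[_ [B [B0 hB] <-]]; rewrite lte_fin => BX.
apply: le_trans (hB t _) _; first by rewrite t0 lexx.
by rewrite lee_fin ler_wpM2r ?nu0// ltW.
Qed.

Lemma X_submod : submod_closed X_pred.
Proof.
have rho0 l m : (rho l m 0%R <= 0)%E by apply: ge_ereal_sup => _ [psi _ <-].
split=> [|a F G].
  rewrite inE /=; exists (fun=> 0), (fun=> 0).
  have c0 : Cup0 (fun=> 0).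
    exists 1; first by rewrite ltr01 lexx.
    split=> //; last by move=> x _; rewrite lexx invr_ge0 ler0n.
    split=> //; by move=> x; exact: cvg_cst.
  split=> //; apply/(rhoX_fin _ _ c0); exists 0 => // t t0.
  by rewrite mul0r; exact: rho0.
rewrite !inE /= => -[mu1 [nu1 [cm1 cn1 /(rhoX_fin _ _ cn1)[B1 B10 h1]]]].
move=> [mu2 [nu2 [cm2 cn2 /(rhoX_fin _ _ cn2)[B2 B20 h2]]]].
have cn := Cup0_max cn1 cn2.
exists (mu1 \max mu2), (nu1 \max nu2); split=> //; first exact: Cup0_max.
apply/(rhoX_fin _ _ cn); exists (normc a * B1 + B2).
  by rewrite addr_ge0// mulr_ge0// normc_ge0.
move=> t t0; apply: le_trans (rho_lin _ _ _ _ _) _.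
rewrite mulrDl -mulrA EFinD; apply: leeD.
  rewrite EFinM lee_wpmul2l ?lee_fin ?normc_ge0//.
  apply: le_trans (le_trans (h1 _ t0) _).
    by apply: rho_incr; rewrite /= le_max lexx.
  by rewrite lee_fin ler_wpM2l//= le_max lexx.
apply: le_trans (le_trans (h2 _ t0) _).
  by apply: rho_incr; rewrite /= le_max lexx orbT.
by rewrite lee_fin ler_wpM2l//= le_max lexx orbT.
Qed.

HB.instance Definition _ := GRing.isSubmodClosed.Build C dist X_pred X_submod.

Record Xspace := XSpace { Xspace_val :> dist ; _ : Xspace_val \in X_pred }.

HB.instance Definition _ := [isSub for Xspace_val].
HB.instance Definition _ := [Choice of Xspace by <:].
HB.instance Definition _ := [SubChoice_isSubLmodule of Xspace by <:].

Definition absconvex (V : lmodType C) (A : set V) : Prop :=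
  forall x y (a b : C), A x -> A y -> normc a + normc b <= 1 ->
    A (a *: x + b *: y).

(* The absolutely convex sets whose trace on each Banach space X^{mu,nu} is a
   neighbourhood of 0: these form the usual base of neighbourhoods of 0 of the
   inductive limit topology of locally convex spaces. *)
Definition lc_nbhs0 (A : set Xspace) : Prop :=
  absconvex A /\
  forall mu nu, Cup0 mu -> Cup0 nu ->
    exists2 r, 0 < r & forall F : Xspace, (rhoX mu nu F < r%:E)%E -> A F.

Definition openX : set (set Xspace) := [set U | forall F, U F ->
  exists2 A, lc_nbhs0 A & forall G, A (G - F) -> U G].

Lemma openX_setT : openX setT.
Proof. by move=> F _; exists setT => //; split=> // mu nu _ _; exists 1. Qed.

Lemma openX_setI : setI_closed openX.
Proof.
move=> U V oU oV F [/oU[A [cA nA] sA] /oV[B [cB nB] sB]].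
exists (A `&` B); last by move=> G [/sA ? /sB ?].
split.
  by move=> x y a b [Ax Bx] [Ay By] ab; split; [exact: cA|exact: cB].
move=> mu nu cm cn; have [r r0 hr] := nA _ _ cm cn; have [q q0 hq] := nB _ _ cm cn.
exists (Order.min r q); first by rewrite lt_min r0 q0.
move=> G; rewrite EFin_min lt_min => /andP[/hr ? /hq ?]; by split.
Qed.

Lemma openX_bigcup (I : Type) (U : I -> set Xspace) :
  (forall i, openX (U i)) -> openX (\bigcup_i U i).
Proof.
move=> oU F [i _ /(oU i)[A nA sA]]; exists A => // G /sA UG.
by exists i.
Qed.

HB.instance Definition _ :=
  isOpenTopological.Build Xspace openX_setT openX_setI openX_bigcup.

Definition FX_pred : {pred fdist} := mem [set F : fdist | fourierT F \in X_pred].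

Lemma fourierT_lin (a : C) (F G : fdist) :
  fourierT (a *: F + G) = a *: fourierT F + fourierT G.
Proof. exact: val_inj. Qed.

Lemma FX_submod : submod_closed FX_pred.
Proof.
split=> [|a F G].
  rewrite inE /= (_ : fourierT 0 = 0); last exact: val_inj.
  exact: (rpred0 X_pred).
rewrite !inE /= => hF hG; rewrite fourierT_lin.
exact: (rpredD (rpredZ a hF) hG).
Qed.

HB.instance Definition _ := GRing.isSubmodClosed.Build C fdist FX_pred FX_submod.

Record FXspace := FXSpace { FXspace_val :> fdist ; _ : FXspace_val \in FX_pred }.

HB.instance Definition _ := [isSub for FXspace_val].
HB.instance Definition _ := [Choice of FXspace by <:].
HB.instance Definition _ := [SubChoice_isSubLmodule of FXspace by <:].

Lemma fourierX_subproof (F : FXspace) : fourierT F \in X_pred.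
Proof. by have := valP F; rewrite inE. Qed.

Definition fourierX (F : FXspace) : Xspace := XSpace (fourierX_subproof F).

HB.instance Definition _ := Topological.copy FXspace (initial_topology fourierX).

(* fourierT v = sum_n a_n delta_n. The sum is over a finite support because psi
   has compact support. *)
Definition has_coefs (v : fdist) (a : nat -> C) : Prop :=
  forall psi : testfun,
    fourierT v psi = \sum_(n \in [set: nat]) a n * psi n%:R.

(* The constant function c = c e^{i0x} as an element of F^{-1}D'(R): its Fourier
   transform is c delta_0. *)
Definition is_constant (v : fdist) (c : C) : Prop :=
  has_coefs v (fun n => if n == 0%N then c else 0).

(* One-sided at the endpoints when D is a closed interval. *)
Definition rderiv_within (D : set R) (f : R -> R) (t d : R) : Prop :=
  ((f x - f t) / (x - t)) @[x --> within D t^'] --> d.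

Definition cderiv_within (D : set R) (f : R -> C) (t : R) (d : C) : Prop :=
  rderiv_within D (Re \o f) t (Re d) /\ rderiv_within D (Im \o f) t (Im d).

Definition fcoef (f : R -> C) (n : int) : C :=
  (2 * pi)^-1%:C *
  cintegral `[0, 2 * pi] (fun x => f x * expi (- (n%:~R * x))).

Definition smooth_torus (f : R -> C) : Prop :=
  smooth f /\ forall x, f (x + 2 * pi) = f x.

Definition japanese (n : int) : R := Num.sqrt (1 + n%:~R ^+ 2).

Definition Hnorm (s : R) (a : int -> C) : \bar R :=
  ((\esum_(n in [set: int]) ((japanese n `^ s * normc (a n)) ^+ 2)%:E) `^ 2^-1)%E.

(* Sequences over N_0 are extended by 0 to the negative frequencies. *)
Definition extend0 (a : nat -> C) (n : int) : C := if n is Posz k then a k else 0.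

End Defs.

Arguments dist : clear implicits.
Arguments fdist : clear implicits.
Arguments testfun : clear implicits.
Arguments ftest : clear implicits.
Arguments Xspace : clear implicits.
Arguments FXspace : clear implicits.

(* Main.v *)
Require Import Defs.
From mathcomp Require Import all_boot all_order all_algebra.
From mathcomp Require Import all_classical all_reals all_analysis.
From mathcomp Require Import complex.
From mathcomp Require Import ring lra.
Set Implicit Arguments.
Unset Strict Implicit.
Unset Printing Implicit Defensive.
Import Order.TTheory GRing.Theory Num.Theory.
Import numFieldNormedType.Exports.
Import ComplexField.Normc.
Local Open Scope classical_set_scope.
Local Open Scope ring_scope.
Local Open Scope complex_scope.

(** The constants are stationary solutions, and the linearization about a
    constant [c > 0] is unstable at high frequencies: [u D^beta u] linearizes to
    [c D^beta u], which makes the mode [n] grow like [exp (c n^beta t)]. Norm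
    inflation follows by taking the datum [c + d e^{iNx}] with [c = eps / 2] and
    [d] chosen so that the second term has norm [eps / 2] in [H^s].

    All frequencies being nonnegative, the interaction is triangular: the equation
    for the mode [n] is [u_n' = (c n^beta - i n^alpha) u_n] plus a source that
    only involves the modes strictly between [0] and [n]
    ([interaction_split]). The modes are therefore obtained one after the other
    by solving scalar linear equations ([triangular_ode_exists]), globally in time
    and without any estimate. The modes strictly between [0] and [N] stay 0, so
    [|u_N(t)| = d exp (c N^beta t)] exactly ([two_mode_solution]). At the time
    [T = eps / 2] the contribution of this single mode to the [H^sigma] norm is
    [<N>^(sigma - s) (eps / 2) exp (eps^2 / 4 N^beta)], which exceeds [1 / eps]
    once [N] is large ([frequency_exists]).

    The higher multiples of [N] may grow in [n] without control, and the space
    [F^{-1} X] is there to accommodate them. A series [sum_n a_n e^{inx}] with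
    arbitrary coefficients is a functional on Fourier transforms of test
    functions: it sends the transform of [psi] to [sum_n a_n psi(n)], a finite
    sum. That this depends on the transform only is the injectivity of the Fourier
    transform ([fourier_inj]), which rests on [cos_moments_eq0]. If [a_0 = 0] the
    measure [sum_n a_n delta_n] lies in X, for the order [mu = 0] and a weight
    [nu] built from the masses ([ramp_sum]). Any growth of the masses in [n] is
    absorbed by [nu]; hence a curve of such series whose coefficients are
    separately Lipschitz in time is continuous with values in X
    ([fxcomb_continuous]). *)

(** * Calculus on the line *)

Section Calculus.
Context {R : realType}.
Notation leb := (@lebesgue_measure R).

Lemma is_derive_lin (k t : R) : is_derive t 1 (fun s : R => k * s) k.
Proof.
by have := is_deriveZ k (is_derive_id t (1 : R)); rewrite /GRing.scale /= mulr1.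
Qed.

Lemma is_derive_cosl (k t : R) :
  is_derive t 1 (fun s : R => cos (k * s)) (- (k * sin (k * t))).
Proof.
apply: (is_derive_eq (is_derive1_comp (is_derive_cos (k * t)) (is_derive_lin k t))).
by rewrite mulNr mulrC.
Qed.

Lemma is_derive_sinl (k t : R) :
  is_derive t 1 (fun s : R => sin (k * s)) (k * cos (k * t)).
Proof.
apply: (is_derive_eq (is_derive1_comp (is_derive_sin (k * t)) (is_derive_lin k t))).
by rewrite mulrC.
Qed.

Lemma continuous_cosl (k : R) : continuous (fun s : R => cos (k * s)).
Proof.
move=> x; apply/differentiable_continuous/derivable1_diffP.
by have [] := is_derive_cosl k x.
Qed.

Lemma continuous_sinl (k : R) : continuous (fun s : R => sin (k * s)).
Proof.
move=> x; apply/differentiable_continuous/derivable1_diffP.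
by have [] := is_derive_sinl k x.
Qed.

Lemma continuous_itv_integrable (f : R -> R) (a b : R) :
  continuous f -> leb.-integrable `[a, b] (EFin \o f).
Proof.
move=> cf; apply: continuous_compact_integrable; first exact: segment_compact.
exact: continuous_subspaceT.
Qed.

Lemma Rintegral_cst_itv (a b c : R) :
  a <= b -> \int[leb]_(x in `[a, b]) c = c * (b - a).
Proof.
move=> ab; rewrite Rintegral_cst//; congr (_ * _).
apply: (etrans (congr1 fine (lebesgue_measure_itv `[a, b]))) => /=.
by rewrite lte_fin -EFinD; case: ltgtP ab => // -> _; rewrite subrr.
Qed.

Lemma antiderivative (g : R -> R) : continuous g ->
  exists2 G, G 0 = 0 & forall x : R, is_derive x 1 G (g x).
Proof.
move=> cg; pose F (K x : R) := \int[leb]_(t in `[- K, x]) g t.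
have FE (L K y : R) : 0 <= L -> L <= K -> - L <= y -> F K y - F K 0 = F L y - F L 0.
  move=> L0 LK Ly.
  have S K' x : - K' <= - L -> - L <= x -> F K' x - F K' (- L) =
      \int[leb]_(t in [set` Interval (BRight (- L)) (BRight x)]) g t.
    move=> KL Lx; apply: Rintegral_itvB; rewrite ?bnd_simp//.
    exact: continuous_itv_integrable.
  have L1 : - L <= 0 by rewrite oppr_le0.
  have K1 : - K <= - L by rewrite lerN2.
  have E (a b c : R) : a - b = (a - c) - (b - c) by ring.
  by rewrite (E _ _ (F K (- L))) (E (F L y) (F L 0) (F L (- L))) (S K y K1 Ly) (S K 0 K1 L1) (S L y (lexx _) Ly) (S L 0 (lexx _) L1).
(* The base point moves with x so that it stays on the left of both x and 0. *)
exists (fun x => F (`|x| + 1) x - F (`|x| + 1) 0); first by rewrite subrr.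
move=> x; pose K : R := `|x| + 2.
have x0 := normr_ge0 x; have := ler_norm (- x); rewrite normrN => xN.
apply: (@near_eq_is_derive _ _ _ (fun y => F K y - F K 0)).
  have := @nbhsx_ballx R R x 1 ltr01; apply: filterS => y.
  rewrite /ball /= => xy.
  have y0 := normr_ge0 y; have := ler_norm (- y); rewrite normrN => yN.
  have yx : `|y| <= `|x| + `|x - y|.
    by rewrite (le_trans _ (ler_normB x (x - y)))// opprB addrC subrK.
  apply: FE; rewrite ?/K; lra.
have xx1 : x < x + 1 by rewrite ltrDl.
have NKx : - K < x by rewrite /K; lra.
have [dF F'] := continuous_FTC1_closed xx1
  (continuous_itv_integrable (- K) (x + 1) cg) NKx (cg x).
have H : is_derive x 1 (F K) (g x).
  by apply: (DeriveDef dF); rewrite -derive1E; exact: F'.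
by have := is_deriveB H (is_derive_cst (F K 0) x 1); rewrite subr0.
Qed.

Lemma C1_lipschitz (f df : R -> R) (T : R) :
  (forall x : R, is_derive x 1 f (df x)) -> continuous df ->
  exists2 L, 0 <= L & forall s t, 0 <= s <= T -> 0 <= t <= T ->
    `|f s - f t| <= L * `|s - t|.
Proof.
move=> fd cdf.
have := compact_bounded (continuous_compact (continuous_subspaceT cdf) (@segment_compact R 0 T)).
move=> [B0 [_ hB]]; pose L : R := Order.max 0 (B0 + 1).
have LB x : 0 <= x <= T -> `|df x| <= L.
  move=> xT; apply: (hB L); first by rewrite lt_max ltrDl ltr01 orbT.
  by exists x.
have cf : continuous f.
  by move=> x; apply/differentiable_continuous/derivable1_diffP; have [] := fd x.
exists L; first by rewrite le_max lexx.
move=> s t; wlog ts : s t / t <= s => [H sT tT|sT tT].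
  have [ts|/ltW st] := leP t s; first exact: H.
  by rewrite distrC [X in _ * X]distrC; exact: H.
have [c cts ->] := @MVT_segment R f df t s ts (fun x _ => fd x) (continuous_subspaceT cf).
rewrite normrM ler_wpM2r// LB//; move: cts; rewrite in_itv/=; lra.
Qed.

Lemma derivable_FTC2 (F f : R -> R) (b : R) : 0 < b ->
  (forall x : R, is_derive x 1 F (f x)) -> continuous f ->
  \int[leb]_(x in `[0, b]) f x = F b - F 0.
Proof.
move=> b0 Fd cf; rewrite /Rintegral.
have cF : continuous F.
  by move=> x; apply/differentiable_continuous/derivable1_diffP; have [] := Fd x.
rewrite (@continuous_FTC2 R f F 0 b b0) //.
- exact: continuous_subspaceT.
- split.
  + by move=> x _; have [] := Fd x.
  + exact: cvg_at_right_filter (cF 0).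
  + exact: cvg_at_left_filter (cF b).
- by move=> x _; rewrite derive1E; have [_ ->] := Fd x.
Qed.

End Calculus.

(** * A continuous compactly supported function with vanishing Fourier transform *)

Section FourierInjective.
Context {R : realType}.
Notation leb := (@lebesgue_measure R).

Lemma continuous_cos_affine (xi b : R) : continuous (fun x => cos (xi * x + b)).
Proof.
move=> x; apply: continuous_comp; last exact: continuous_cos.
by apply: cvgD; [apply: cvgM; [exact: cvg_cst|exact: cvg_id]|exact: cvg_cst].
Qed.

Lemma continuous_cos_affine_pow (a c : R) (k : nat) :
  continuous (fun x => cos (a * x + c) ^+ k).
Proof.
move=> x; apply: (@continuous_comp _ _ _ (fun x => cos (a * x + c)) (fun y => y ^+ k)).
  exact: continuous_cos_affine.
exact: exprn_continuous.
Qed.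

Lemma cosM (x y : R) : cos x * cos y = (cos (y + x) + cos (y - x)) / 2.
Proof. by rewrite cosD cosB; field. Qed.

(** The product formula for cosines turns multiplication by [cos (a x + c)] into
    a shift of the frequency, so the vanishing of all moments is inherited. *)
Lemma cos_moments_powM (f : R -> R) (u v a c : R) (k : nat) :
  continuous f ->
  (forall xi b, \int[leb]_(x in `[u, v]) (f x * cos (xi * x + b)) = 0) ->
  forall xi b,
    \int[leb]_(x in `[u, v]) (f x * cos (a * x + c) ^+ k * cos (xi * x + b)) = 0.
Proof.
move=> cf f0; elim: k => [|k IH] xi b.
  by under eq_Rintegral do rewrite expr0 mulr1; exact: f0.
pose g x := f x * cos (a * x + c) ^+ k.
have cg : continuous g.
  move=> x; apply: cvgM; first exact: cf.
  exact: continuous_cos_affine_pow.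
have ig xi' b' : leb.-integrable `[u, v] (EFin \o (fun x => g x * cos (xi' * x + b'))).
  apply: continuous_itv_integrable => x; apply: cvgM; first exact: cg.
  exact: continuous_cos_affine.
transitivity (\int[leb]_(x in `[u, v])
    ((g x * cos ((xi + a) * x + (b + c)) + g x * cos ((xi - a) * x + (b - c))) * 2^-1)).
  apply: eq_Rintegral => x _; rewrite /g exprSr.
  rewrite (_ : (xi + a) * x + (b + c) = xi * x + b + (a * x + c)); last by ring.
  rewrite (_ : (xi - a) * x + (b - c) = xi * x + b - (a * x + c)); last by ring.
  by rewrite -mulrDr -[RHS]mulrA -cosM; ring.
rewrite RintegralZr//; last exact: (integrableD _ (ig _ _) (ig _ _)).
by rewrite RintegralD// IH IH addr0 mul0r.
Qed.

Lemma cos_le_cos_of_dist (x y : R) : `|x| <= `|y| -> `|y| <= 1 -> cos y <= cos x.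
Proof.
move=> xy y1; rewrite -cos_norm -(cos_norm x) leNgt ltr_cos ?in_itv/= ?normr_ge0/=; last 2 first.
- by have := @pi_ge2 R; lra.
- by have := @pi_ge2 R; lra.
by rewrite -leNgt.
Qed.

Lemma cos_gt0_1 (x : R) : `|x| <= 1 -> 0 < cos x.
Proof.
move=> x1; rewrite -cos_norm; apply: cos_gt0_pihalf.
have pi3 : 1 < pi / 2 :> R.
  rewrite lt_neqAle pihalf_ge1 andbT; apply/eqP => pi1.
  have := @cos_pihalf R; rewrite -pi1; have := @cos1_gt0 R; lra.
by have := normr_ge0 x; lra.
Qed.

(** If [f x0 > 0], integrate [f] against the powers [cos (a (x - x0)) ^ k]. Near
    [x0], where [f >= f x0 / 2], the kernel is at least [q ^ k]; where [f] may be
    negative it is at most [r ^ k] with [r < q]. For large [k] the first part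
    wins, although the integral is 0. *)
Lemma cos_moments_le0 (f : R -> R) (M : R) :
  continuous f -> (forall x, M < `|x| -> f x = 0) ->
  (forall xi b, \int[leb]_(x in `[- M, M]) (f x * cos (xi * x + b)) = 0) ->
  forall x, f x <= 0.
Proof.
move=> cf f0 fm x0; rewrite leNgt; apply/negP => fx0.
have x0M : `|x0| <= M by rewrite leNgt; apply/negP => /f0 E; rewrite E ltxx in fx0.
have [d d0 fd] : exists2 d : R, 0 < d & forall x, `|x - x0| < d -> f x0 / 2 <= f x.
  have /cvgrPdist_lt := cf x0.
  move=> /(_ (f x0 / 2)); rewrite divr_gt0// => /(_ isT).
  move=> /nbhs_ballP[d /= d0 hd]; exists d => // x xd.
  have /hd /= : ball x0 d x by rewrite /ball /= distrC.
  rewrite ltr_norml; lra.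
have M0 : 0 < M.
  have : f (x0 + d / 2) != 0.
    apply/eqP => E; have := fd (x0 + d / 2).
    rewrite E addrAC subrr add0r gtr0_norm; lra.
  move=> fE; have : `|x0 + d / 2| <= M by rewrite leNgt; apply/negP => /f0 E; rewrite E eqxx in fE.
  move: x0M; rewrite !ler_norml; lra.
have NMM : - M <= M by lra.
(* On the support the argument of the kernel stays in [-1, 1], where the cosine
   is positive and decreases away from 0. *)
pose a := (2 * M)^-1; pose h x := cos (a * x + - (a * x0)).
have a0 : 0 < a by rewrite invr_gt0; lra.
have hE x : h x = cos (a * (x - x0)) by rewrite /h mulrBr.
have aM x : `|x| <= M -> `|a * (x - x0)| <= 1.
  move=> xM; rewrite normrM (gtr0_norm a0) mulrC ler_pdivrMr ?mul1r; last lra.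
  by rewrite (le_trans (ler_normB _ _))//; lra.
pose e : R := Order.min d M.
have e0 : 0 < e by rewrite lt_min d0.
have eM : e <= M by rewrite ge_min lexx orbT.
have ed : e <= d by rewrite ge_min lexx.
pose q := cos (a * (e / 2)); pose r := cos (a * e).
have aeM : a * e <= 1 by rewrite mulrC ler_pdivrMr; lra.
have ae0 : 0 < a * e by rewrite mulr_gt0.
have r0 : 0 < r by apply: cos_gt0_1; rewrite gtr0_norm.
have rq : r < q.
  by rewrite ltr_cos ?in_itv/=; have := @pi_ge2 R; lra.
have [B B0 fB] : exists2 B : R, 0 < B & forall x, `|f x| <= B.
  have := compact_bounded (continuous_compact (continuous_subspaceT cf) (@segment_compact R (- M) M)).
  move=> [B0 [_ hB]]; exists (Order.max 1 (B0 + 1)); first by rewrite lt_max ltr01.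
  move=> x; have [xM|/f0 ->] := leP `|x| M; last by rewrite normr0 le_max ler01.
  apply: (hB (Order.max 1 (B0 + 1))); first by rewrite lt_max ltrDl ltr01 orbT.
  by exists x => //=; rewrite in_itv/= -ler_norml.
pose I : set R := `[x0 - e / 2, x0 + e / 2]%classic.
have Idist x : I x -> `|x - x0| <= e / 2.
  by rewrite /I /= in_itv/= ler_norml; lra.
have IM : I `<=` `[- M, M].
  move=> x Ix; rewrite /= in_itv/= -ler_norml leNgt; apply/negP => /f0 E.
  have := fd x; rewrite E; have := Idist x Ix; lra.
have key k : f x0 / 2 * q ^+ k * e <= 2 * M * (B * r ^+ k).
  pose g x := f x * h x ^+ k + B * r ^+ k.
  have ch : continuous (fun x => f x * h x ^+ k).
    move=> x; apply: cvgM; first exact: cf.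
    exact: continuous_cos_affine_pow.
  have ih := continuous_itv_integrable (- M) M ch.
  have cg : continuous g by move=> x; apply: cvgD; [exact: ch|exact: cvg_cst].
  have ig := continuous_itv_integrable (- M) M cg.
  have brk : 0 < B * r ^+ k by rewrite mulr_gt0// exprn_gt0.
  have g0 x : `[- M, M]%classic x -> 0 <= g x.
    rewrite /= in_itv/= -ler_norml => xM.
    have h0 : 0 < h x by rewrite hE; apply: cos_gt0_1; exact: aM.
    have [xe|xe] := ltP `|x - x0| e.
      have := fd x; rewrite (lt_le_trans xe ed) => /(_ isT) fx.
      by rewrite addr_ge0 ?(ltW brk)// mulr_ge0 ?exprn_ge0 ?(ltW h0)//; lra.
    have hr : h x <= r.
      rewrite hE; apply: cos_le_cos_of_dist; last exact: aM.
      by rewrite (gtr0_norm ae0) normrM (gtr0_norm a0) ler_pM2l.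
    have : `|f x * h x ^+ k| <= B * r ^+ k.
      rewrite normrM ler_pM// normrX (gtr0_norm h0).
      by apply: lerXn2r => //; rewrite nnegrE ltW.
    by rewrite ler_norml /g; lra.
  have fin E : measurable E -> E `<=` `[- M, M] -> (\int[leb]_(x in E) (g x)%:E)%E \is a fin_num.
    move=> mE sE; apply: integrable_fin_num => //.
    exact: integrableS ig.
  have mI : measurable I by exact: measurable_itv.
  have LE : \int[leb]_(x in I) g x <= \int[leb]_(x in `[- M, M]) g x.
    apply: fine_le; [exact: fin|exact: fin|].
    apply: ge0_subset_integral => //.
    by move/integrableP: ig => [].
  have LB : f x0 / 2 * q ^+ k * e <= \int[leb]_(x in I) g x.
    have -> : f x0 / 2 * q ^+ k * e = \int[leb]_(x in I) (f x0 / 2 * q ^+ k).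
      by rewrite Rintegral_cst_itv; [congr (_ * _); lra|lra].
    apply: le_Rintegral => //.
    - by apply: continuous_itv_integrable => x; exact: cvg_cst.
    - exact: integrableS ig.
    - move=> x Ix; have xM : `|x| <= M by have := IM _ Ix; rewrite /= in_itv/= -ler_norml.
      have := Idist x Ix => xe.
      have qh : q <= h x.
        rewrite hE; apply: cos_le_cos_of_dist.
          rewrite !(normrM a) (gtr0_norm a0) ler_pM2l// [leRHS]gtr0_norm; lra.
        have ae2 : 0 < a * (e / 2) by rewrite mulr_gt0 ?divr_gt0.
        by rewrite gtr0_norm// mulrA; lra.
      have : f x0 / 2 * q ^+ k <= f x * h x ^+ k.
        have q0 : 0 < q by exact: lt_trans rq.
        apply: ler_pM; [lra|exact/exprn_ge0/ltW|apply: fd; lra|].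
        by apply: lerXn2r => //; rewrite nnegrE ltW// (lt_le_trans q0).
      by move=> /le_trans; apply; rewrite /g lerDl ltW.
  have UB : \int[leb]_(x in `[- M, M]) g x = 2 * M * (B * r ^+ k).
    rewrite RintegralD//; last by apply: continuous_itv_integrable => x; exact: cvg_cst.
    have -> : \int[leb]_(x in `[- M, M]) (f x * h x ^+ k) = 0.
      rewrite -[RHS](cos_moments_powM a (- (a * x0)) k cf fm 0 0).
      by apply: eq_Rintegral => x _; rewrite mul0r add0r cos0 mulr1.
    by rewrite add0r Rintegral_cst_itv// opprK -mulr2n mulr_natl mulrC.
  by rewrite -UB (le_trans LB LE).
have q0 : 0 < q by exact: lt_trans rq.
have rq1 : `|r / q| < 1 by rewrite gtr0_norm ?divr_gt0// ltr_pdivrMr// mul1r.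
have /cvgrPdist_lt := cvg_expr rq1.
have c0 : 0 < f x0 / 2 * e / (2 * M * B).
  by apply: divr_gt0; apply: mulr_gt0 => //; lra.
move=> /(_ _ c0)[k _ /(_ k (leqnn k))] /=.
rewrite sub0r normrN gtr0_norm ?exprn_gt0 ?divr_gt0// expr_div_n.
rewrite ltr_pdivlMr; last by apply: mulr_gt0 => //; lra.
rewrite mulrAC ltr_pdivrMr ?exprn_gt0//.
by have := key k; lra.
Qed.

Lemma cos_moments_eq0 (f : R -> R) (M : R) :
  continuous f -> (forall x, M < `|x| -> f x = 0) ->
  (forall xi b, \int[leb]_(x in `[- M, M]) (f x * cos (xi * x + b)) = 0) ->
  forall x, f x = 0.
Proof.
move=> cf f0 fm x; apply/eqP; rewrite eq_le (cos_moments_le0 cf f0 fm)/=.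
rewrite -oppr_le0.
apply: (@cos_moments_le0 (fun x => - f x) M) => [y|y yM|xi b].
- by apply: cvgN; exact: cf.
- by rewrite f0// oppr0.
- under eq_Rintegral do rewrite mulNr -mulN1r.
  rewrite RintegralZl ?fm ?mulr0//.
  apply: continuous_itv_integrable => y; apply: cvgM; first exact: cf.
  exact: continuous_cos_affine.
Qed.

End FourierInjective.

(** * Injectivity of the Fourier transform on test functions *)

Section FourierInjectiveTest.
Context {R : realType}.
Local Notation C := R[i].
Notation leb := (@lebesgue_measure R).
Local Notation Re := (@complex.Re R).
Local Notation Im := (@complex.Im R).

Lemma testfun_bounded_supp (psi : testfun R) :
  exists M : R, forall x, M < `|x| -> psi x = 0.
Proof.
have [_ /compact_bounded[M [_ hM]]] := testfunP psi.
exists (M + 1) => x Mx; apply: contrapT => /eqP px.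
have : `|x| <= M + 1.
  by apply: (hM (M + 1)); [rewrite ltrDl|exact: subset_closure].
by rewrite leNgt Mx.
Qed.

Lemma testfun_continuous (psi : testfun R) :
  continuous (fun x => Re (psi x)) /\ continuous (fun x => Im (psi x)).
Proof.
by have [[s1 s2] _] := testfunP psi; split; exact: derivable1n_cont.
Qed.

(** Comparing the transform at [xi] and at [- xi] separates the four real moments
    of the real and imaginary parts against [cos] and [sin]. *)
Lemma fourier_eq0 (psi : testfun R) :
  fourier psi = (fun=> 0) -> forall x, psi x = 0.
Proof.
move=> psi0; have [M hM] := testfun_bounded_supp psi.
have [cR cI] := testfun_continuous psi.
have cc := @continuous_cosl R; have cs := @continuous_sinl R.
have c0 : continuous (fun _ : R => 0 : R) by move=> x; exact: cvg_cst.
have iR h : continuous h -> leb.-integrable setT (EFin \o (fun x => Re (psi x) * h x)).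
  move=> ch; have := compact_supp_integrable psi ch c0.
  by congr (_.-integrable _ _); apply/funext => x /=; rewrite mulr0 addr0.
have iI h : continuous h -> leb.-integrable setT (EFin \o (fun x => Im (psi x) * h x)).
  move=> ch; have := compact_supp_integrable psi c0 ch.
  by congr (_.-integrable _ _); apply/funext => x /=; rewrite mulr0 add0r.
pose Cp xi := \int[leb]_(x in setT) (Re (psi x) * cos (xi * x)).
pose Sp xi := \int[leb]_(x in setT) (Re (psi x) * sin (xi * x)).
pose Cq xi := \int[leb]_(x in setT) (Im (psi x) * cos (xi * x)).
pose Sq xi := \int[leb]_(x in setT) (Im (psi x) * sin (xi * x)).
have E xi : Cp xi + Sq xi = 0 /\ Cq xi - Sp xi = 0.
  have /eqP := congr1 (fun g => g xi) psi0.
  rewrite /fourier mulf_eq0 => /orP[/eqP/(congr1 Re)/= /eqP|].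
    by rewrite invr_eq0 mulf_eq0 (gt_eqF (pi_gt0 R)) pnatr_eq0.
  rewrite /cintegral => /eqP[E1 E2]; split.
    rewrite -[RHS]E1 -RintegralD//; [|exact: iR|exact: iI].
    apply: eq_Rintegral => x _; rewrite Defs.ReM /= cosN sinN mulrN opprK.
    by rewrite (mulrC x).
  rewrite -[RHS]E2 -RintegralB//; [|exact: iI|exact: iR].
  apply: eq_Rintegral => x _; rewrite Defs.ImM /= cosN sinN mulrN.
  by rewrite (mulrC x).
have Neven (f : R -> R) xi : \int[leb]_(x in setT) (f x * cos (- xi * x)) =
    \int[leb]_(x in setT) (f x * cos (xi * x)).
  by apply: eq_Rintegral => x _; rewrite mulNr cosN.
have Nodd (f : R -> R) xi : leb.-integrable setT (EFin \o (fun x => f x * sin (xi * x))) ->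
    \int[leb]_(x in setT) (f x * sin (- xi * x)) =
    - \int[leb]_(x in setT) (f x * sin (xi * x)).
  move=> fi; rewrite -[RHS]mulN1r -RintegralZl//.
  by apply: eq_Rintegral => x _; rewrite mulNr sinN mulrN mulN1r.
have Z xi : [/\ Cp xi = 0, Sp xi = 0, Cq xi = 0 & Sq xi = 0].
  have [E1 E2] := E xi; have [] := E (- xi).
  rewrite {1}/Cp {1}/Sq {1}/Cq {1}/Sp !Neven !Nodd; [|exact: iR|exact: iI].
  rewrite -/(Cp _) -/(Sq _) -/(Cq _) -/(Sp _) => E3 E4; split; lra.
have fin (f : R -> R) : continuous f -> (forall x, M < `|x| -> f x = 0) ->
    (forall h, continuous h -> leb.-integrable setT (EFin \o (fun x => f x * h x))) ->
    (forall xi, \int[leb]_(x in setT) (f x * cos (xi * x)) = 0) ->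
    (forall xi, \int[leb]_(x in setT) (f x * sin (xi * x)) = 0) ->
    forall x, f x = 0.
  move=> cf f0 fi fc fs; apply: (cos_moments_eq0 cf f0) => xi b.
  transitivity (\int[leb]_(x in setT) (f x * cos (xi * x + b))).
    rewrite Rintegral_mkcond; apply: eq_Rintegral => x _; rewrite patchE.
    case: ifPn => // /negP xM; rewrite f0 ?mul0r// ltNge; apply/negP => xM'.
    by apply: xM; rewrite inE /= in_itv/= -ler_norml.
  transitivity (\int[leb]_(x in setT)
      (f x * cos (xi * x) * cos b - f x * sin (xi * x) * sin b)).
    by apply: eq_Rintegral => x _; rewrite cosD; ring.
  have ic := fi _ (cc xi); have isn := fi _ (cs xi).
  rewrite RintegralB//; last 2 first.
  - by have := integrableZr measurableT (cos b) ic.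
  - by have := integrableZr measurableT (sin b) isn.
  by rewrite !RintegralZr// fc fs !mul0r subrr.
move=> x; apply/eqP; rewrite eq_complex; apply/andP; split; apply/eqP => /=.
- apply: (fin (fun x => Re (psi x))) => //.
  + by move=> y /hM ->.
  + by move=> xi; have [] := Z xi.
  + by move=> xi; have [] := Z xi.
- apply: (fin (fun x => Im (psi x))) => //.
  + by move=> y /hM ->.
  + by move=> xi; have [] := Z xi.
  + by move=> xi; have [] := Z xi.
Qed.

Lemma fourier_inj (psi phi : testfun R) : fourier psi = fourier phi -> psi = phi.
Proof.
move=> E; have : forall x, (- 1 *: phi + psi : testfun R) x = 0.
  by apply: fourier_eq0; rewrite fourier_lin E; apply/funext => xi; rewrite mulN1r addNr.
move=> H; apply: val_inj; apply/funext => x; have := H x.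
by rewrite testfun_lin mulN1r addrC => /eqP; rewrite subr_eq0 => /eqP.
Qed.

End FourierInjectiveTest.

(** * Fourier series with arbitrary coefficients as generalized functions *)

Lemma fsum_nat_truncate (V : zmodType) (F : nat -> V) (K : nat) :
  (forall n, (K <= n)%N -> F n = 0) ->
  \sum_(n \in [set: nat]) F n = \sum_(n < K) F n.
Proof.
move=> F0; rewrite fsbig_ord; apply/esym/fsbig_widen => // n [_ /= /negP].
by rewrite -leqNgt => /F0.
Qed.

Section Comb.
Context {R : realType}.
Local Notation C := R[i].
Local Notation Re := (@complex.Re R).
Local Notation Im := (@complex.Im R).

Lemma normc_sum (n : nat) (F : nat -> C) :
  normc (\sum_(i < n) F i) <= \sum_(i < n) normc (F i).
Proof.
elim: n => [|n IH]; first by rewrite !big_ord0 (normc0 R).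
by rewrite !big_ord_recr /= (le_trans (le_normcD _ _))// lerD2r.
Qed.

Lemma Re_le_normc (z : C) : Re z <= normc z.
Proof.
case: z => x y /=; apply: (le_trans (ler_norm x)).
by rewrite -sqrtr_sqr ler_wsqrtr// lerDl sqr_ge0.
Qed.

Lemma cderiv0 (f : R -> C) x : cderiv 0 f x = f x.
Proof. by rewrite /cderiv /=; case: (f x). Qed.

(** The measure with mass [a n] at each natural number [n], as a functional on
    test functions. *)
Definition comb (a : nat -> C) (psi : testfun R) : C :=
  \sum_(n \in [set: nat]) a n * psi n%:R.

Lemma combE (a : nat -> C) (psi : testfun R) (K : nat) :
  (forall n, (K <= n)%N -> psi n%:R = 0) ->
  comb a psi = \sum_(n < K) a n * psi n%:R.
Proof.
by move=> p0; apply: fsum_nat_truncate => n /p0 ->; rewrite mulr0.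
Qed.

Lemma comb_truncation (psi : testfun R) :
  exists K, forall n, (K <= n)%N -> psi n%:R = 0.
Proof.
have [M hM] := testfun_bounded_supp psi.
exists (Num.truncn M).+1 => n Kn; apply: hM; rewrite ger0_norm//.
by rewrite (lt_le_trans (truncnS_gt M))// ler_nat.
Qed.

Lemma comb_linear (a : nat -> C) : linear (comb a : testfun R -> C^o).
Proof.
move=> b f g; have [K1 h1] := comb_truncation f; have [K2 h2] := comb_truncation g.
have h1' n : (maxn K1 K2 <= n)%N -> f n%:R = 0.
  by rewrite geq_max => /andP[/h1].
have h2' n : (maxn K1 K2 <= n)%N -> g n%:R = 0.
  by rewrite geq_max => /andP[_ /h2].
rewrite -[RHS]/(b * comb a f + comb a g).
rewrite (combE _ h1') (combE _ h2') (@combE _ _ (maxn K1 K2)); last first.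
  by move=> n nK; rewrite testfun_lin h1'// h2'// mulr0 addr0.
rewrite mulr_sumr -big_split /=; apply: eq_bigr => n _.
transitivity (a n * (b * f n%:R + g n%:R)); first by [].
by ring.
Qed.

Lemma comb_dist (a : nat -> C) : (comb a : testfun R -> C^o) \in @dist_pred R.
Proof.
rewrite inE /=; split; first exact: comb_linear.
move=> K /compact_bounded[M [_ hM]]; pose N := (Num.truncn (M + 1)).+1.
exists 0%N, (\sum_(n < N) normc (a n)); split.
  by apply: sumr_ge0 => n _; exact: normc_ge0.
move=> psi sK; rewrite big_ord1.
rewrite (@combE _ _ N); last first.
  move=> n Nn; apply: contrapT => /eqP px.
  have : `|n%:R : R| <= M + 1.
    apply: (hM (M + 1)); first by rewrite ltrDl.
    by apply: sK; exact: subset_closure.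
  rewrite leNgt ger0_norm// (lt_le_trans (truncnS_gt (M + 1)))//.
  by rewrite ler_nat.
apply: (@le_trans _ _ (\sum_(n < N) (normc (a n) * normc (psi n%:R))%:E)%E).
  rewrite sumEFin lee_fin (le_trans (normc_sum _ (fun n => a n * psi n%:R)))//.
  by apply: ler_sum => n _; rewrite normcM.
rewrite -sumEFin ge0_sume_distrl; last by move=> n _; rewrite lee_fin normc_ge0.
apply: lee_sum => n _; rewrite EFinM lee_wpmul2l ?lee_fin ?normc_ge0//.
by apply: ereal_sup_ubound; exists n%:R => //; rewrite cderiv0.
Qed.

Lemma ftest_testfun (g : ftest R) : exists psi, g = fourierD psi.
Proof.
have := valP g; rewrite inE => -[psi E]; exists psi; exact: val_inj.
Qed.

(** A functional on Fourier transforms of test functions evaluates at [g] through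
    the test function whose transform is [g]; this is unambiguous because the
    Fourier transform is injective. *)
Definition fcomb_fun (a : nat -> C) (g : ftest R) : C^o :=
  comb a (projT1 (cid (ftest_testfun g))).

Lemma fcomb_fourierD a psi : fcomb_fun a (fourierD psi) = comb a psi.
Proof.
rewrite /fcomb_fun; case: cid => phi /= E; congr comb; apply: fourier_inj.
exact/esym/(congr1 (@ftest_val R) E).
Qed.

Lemma fcomb_fdist (a : nat -> C) : fcomb_fun a \in @fdist_pred R.
Proof.
rewrite inE /=; split; last first.
  have -> : fcomb_fun a \o (@fourierD R) = comb a.
    by apply/funext => psi; exact: fcomb_fourierD.
  exact: comb_dist.
move=> b f g; have [psi ->] := ftest_testfun f; have [phi ->] := ftest_testfun g.
by rewrite -fourierD_linear !fcomb_fourierD comb_linear.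
Qed.

(** The Fourier series [sum_n a n e^{inx}]. Its coefficients may grow arbitrarily
    fast, since pairing it with the transform of a compactly supported function
    involves finitely many of them. *)
Definition fcomb (a : nat -> C) : fdist R := FDist (fcomb_fdist a).

Lemma fourierT_fcomb a psi : fourierT (fcomb a) psi = comb a psi.
Proof. exact: fcomb_fourierD. Qed.

Lemma fcomb_coefs a : has_coefs (fcomb a) a.
Proof. exact: fourierT_fcomb. Qed.

Lemma combB (a b : nat -> C) psi :
  comb (fun n => a n - b n) psi = comb a psi - comb b psi.
Proof.
have [K h] := comb_truncation psi; rewrite !(combE _ h) -sumrB.
by apply: eq_bigr => n _; rewrite mulrBl.
Qed.

Lemma fcombB (a b : nat -> C) : fcomb (fun n => a n - b n) = fcomb a - fcomb b.
Proof.
apply: val_inj; apply/funext => g; have [psi ->] := ftest_testfun g.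
have -> : val (fcomb a - fcomb b) (fourierD psi) =
  fcomb a (fourierD psi) - fcomb b (fourierD psi) by [].
by rewrite /= !fcomb_fourierD combB.
Qed.

End Comb.

(** * Fourier series with zero mean in the space X *)

Section SpaceX.
Context {R : realType}.
Local Notation C := R[i].
Local Notation Re := (@complex.Re R).

(** The weight [nu] used below for a measure whose mass at [n] is at most [A n].
    It is continuous, vanishes on [[0, 1/2]] when [A 0 = 0], and dominates the
    total mass to the left of [t], since [2 t - n >= 1] as soon as [1 <= n < t]. *)
Definition ramp_sum (A : nat -> R) (t : R) : R :=
  \sum_(n \in [set: nat]) A n * Num.max 0 (2 * t - n%:R).

Lemma ramp_sumE (A : nat -> R) (K : nat) (t : R) : 2 * t <= K%:R ->
  ramp_sum A t = \sum_(n < K) A n * Num.max 0 (2 * t - n%:R).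
Proof.
move=> tK; apply: fsum_nat_truncate => n Kn.
rewrite max_l ?mulr0// subr_le0 (le_trans tK)// ler_nat.
by [].
Qed.

Lemma ramp_sum_continuous (A : nat -> R) : continuous (ramp_sum A).
Proof.
(* Near t the sum is finite, with a number of terms independent of the point. *)
move=> t; pose K := (Num.truncn (2 * (t + 1))).+1.
have KE s : s < t + 1 -> ramp_sum A s = \sum_(n < K) A n * Num.max 0 (2 * s - n%:R).
  move=> st; apply: ramp_sumE; rewrite ltW// (lt_trans _ (truncnS_gt _))//.
  by rewrite ltr_pM2l.
have tt : t < t + 1 by rewrite ltrDl.
rewrite /continuous_at KE//.
have H : (\sum_(n < K) A n * Num.max 0 (2 * s - n%:R)) @[s --> t] -->
    \sum_(n < K) A n * Num.max 0 (2 * t - n%:R).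
  apply: cvg_big => [|n _]; first exact: add_continuous; apply: cvgM; first exact: cvg_cst.
  apply: (@continuous_max _ _ (fun=> 0) (fun s : R => 2 * s - n%:R)); first exact: cvg_cst.
  apply: cvgB; last exact: cvg_cst.
  by apply: cvgM; [exact: cvg_cst|exact: cvg_id].
apply: cvg_trans H; apply: near_eq_cvg; near=> s.
by apply/esym/KE; near: s; exact: lt_nbhsl.
Unshelve. all: by end_near. Qed.

Lemma ramp_sum_Cup0 (A : nat -> R) : A 0%N = 0 -> (forall n, 0 <= A n) ->
  Cup0 (ramp_sum A).
Proof.
move=> A0 Age.
have z x : x <= 2^-1 -> ramp_sum A x = 0.
  move=> x2; rewrite (@ramp_sumE A 1); last lra.
  by rewrite big_ord1 A0 mul0r.
have p x : 0 <= ramp_sum A x.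
  by apply: fsumr_ge0 => n _; rewrite mulr_ge0// le_max lexx.
exists 4^-1; first by apply/andP; split; lra.
split; first split.
- exact/continuous_subspaceT/ramp_sum_continuous.
- move=> x y _ _ xy; pose K := (Num.truncn (2 * y)).+1.
  have yK : 2 * y <= K%:R by rewrite ltW// truncnS_gt.
  rewrite (ramp_sumE _ yK) (@ramp_sumE _ K); last by rewrite (le_trans _ yK)// ler_pM2l.
  apply: ler_sum => n _; rewrite ler_wpM2l// ge_max !le_max lexx/=.
  by apply/orP; right; lra.
- by move=> x _; exact: p.
- by apply: z; rewrite invr_ge0.
- by move=> x /andP[_ x2]; rewrite z; [rewrite lexx invr_ge0/=|lra].
Qed.

Lemma Cup0_0 : Cup0 (fun=> 0 : R).
Proof.
exists 1; first by rewrite ltr01 lexx.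
split=> //; last by move=> x _; rewrite lexx invr_ge0 ler0n.
by split=> //; move=> x; exact: cvg_cst.
Qed.

(** A test function supported to the left of [t] only meets the masses at [n < t],
    and measures are controlled by the supremum of the test function alone, which
    is why the order [0] suffices. *)
Lemma rho_comb (F : dist R) (a : nat -> C) (A : nat -> R) (B t : R) :
  (forall psi, F psi = comb a psi) -> a 0%N = 0 ->
  (forall n, normc (a n) <= B * A n) ->
  (rho t 0 F <= (B * ramp_sum A t)%:E)%E.
Proof.
move=> FE a0 aA; have BA n : 0 <= B * A n by exact: le_trans (normc_ge0 _) (aA n).
apply: ge_ereal_sup => _ [psi [sp np] <-]; rewrite FE lee_fin.
have st x : psi x != 0 -> x < t by move=> px; apply: sp; exact: subset_closure.
have p1 x : 0 <= x -> normc (psi x) <= 1.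
  move=> x0; rewrite -lee_fin; apply: le_trans np.
  apply: (@le_trans _ _ (sup_deriv 0 [set xi | 0 <= xi] psi)).
    by apply: ereal_sup_ubound; exists x => //; rewrite cderiv0.
  by apply: ereal_sup_ubound; exists 0%N => /=.
have [K1 h1] := comb_truncation psi.
pose K := maxn K1 (Num.truncn (2 * t)).+1.
have hK n : (K <= n)%N -> psi n%:R = 0 by rewrite geq_max => /andP[/h1].
have tK : 2 * t <= K%:R.
  by rewrite (le_trans (ltW (truncnS_gt _)))// ler_nat leq_maxr.
rewrite (combE _ hK) (ramp_sumE _ tK) (le_trans (Re_le_normc _))//.
rewrite (le_trans (normc_sum _ (fun n => a n * psi n%:R)))// mulr_sumr.
apply: ler_sum => n _; rewrite normcM mulrA.
have [n0|n0] := eqVneq (nat_of_ord n) 0%N.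
  by rewrite n0 a0 (normc0 R) mul0r mulr_ge0// le_max lexx.
have [->|/st nt] := eqVneq (psi n%:R) 0.
  by rewrite (normc0 R) mulr0 mulr_ge0// le_max lexx.
apply: ler_pM => //; try exact: normc_ge0.
apply: (le_trans (p1 _ _)) => //; rewrite le_max; apply/orP; right.
have : (1 : R) <= n%:R by rewrite ler1n lt0n.
lra.
Qed.

Lemma rhoX_comb (F : dist R) (a : nat -> C) (A : nat -> R) (B : R) :
  0 <= B -> (forall psi, F psi = comb a psi) -> a 0%N = 0 ->
  (forall n, normc (a n) <= B * A n) ->
  (rhoX (fun=> 0%R) (ramp_sum A) F <= B%:E)%E.
Proof.
move=> B0 FE a0 aA; apply: ge_ereal_sup => _ [l _ <-].
apply: ereal_inf_lbound; exists B => //; split=> // t _.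
exact: rho_comb FE a0 aA.
Qed.

Lemma fcomb_FX (a : nat -> C) : a 0%N = 0 -> fcomb a \in @FX_pred R.
Proof.
move=> a0; rewrite inE /= inE /=; exists (fun=> 0), (ramp_sum (fun n => normc (a n))).
split; first exact: Cup0_0.
- by apply: ramp_sum_Cup0 => [|n]; [rewrite a0 (normc0 R)|exact: normc_ge0].
- apply: (@le_lt_trans _ _ 1%:E); last exact: ltry.
  apply: (rhoX_comb _ (fourierT_fcomb a) a0) => // n.
  by rewrite mul1r.
Qed.

Definition fxcomb (a : nat -> C) (a0 : a 0%N = 0) : FXspace R :=
  FXSpace (fcomb_FX a0).

(** Termwise Lipschitz continuity of the coefficients, with constants of any
    growth in [n], is enough: the constants only enter the weight [ramp_sum]. *)
Lemma fxcomb_continuous (D : set R) (v : R -> nat -> C) (L : nat -> R)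
    (v0 : forall t, v t 0%N = 0) :
  (forall n, 0 <= L n) ->
  (forall n s t, D s -> D t -> normc (v s n - v t n) <= L n * `|s - t|) ->
  {within D, continuous (fun t => fxcomb (v0 t))}.
Proof.
move=> L0 vL; apply: (@continuous_comp_initial _ _ _ (@fourierX R)).
apply/subspace_continuousP => t Dt U.
rewrite nbhsE => -[V [oV Vt] VU].
have [A [_ nA] AV] := oV _ Vt.
pose L' n := if n == 0%N then 0 else L n.
have L'0 n : 0 <= L' n by rewrite /L'; case: ifP.
have [r r0 hr] := nA _ _ Cup0_0 (ramp_sum_Cup0 (erefl : L' 0%N = 0) L'0).
apply: (@filterS _ (nbhs t) _ _ _ _ (nbhsx_ballx t _ r0)) => s st Ds; apply/VU/AV/hr.
rewrite /ball /= distrC in st.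
apply: (@le_lt_trans _ _ (`|s - t|)%:E); last by rewrite lte_fin.
apply: (@rhoX_comb _ (fun n => v s n - v t n)) => //.
- move=> psi; rewrite combB -!fourierT_fcomb. reflexivity.
- by rewrite !v0 subrr.
- move=> n; rewrite /L'; case: eqP => [->|_].
    by rewrite !v0 subrr (normc0 R) mulr0.
  by rewrite mulrC; exact: vL.
Qed.

End SpaceX.

(** * Triangular systems of ordinary differential equations *)

Section ComplexCurves.
Context {R : realType}.
Local Notation C := R[i].
Local Notation Re := (@complex.Re R).
Local Notation Im := (@complex.Im R).

Definition ccontinuous (f : R -> C) : Prop :=
  continuous (Re \o f) /\ continuous (Im \o f).

Definition cis_derive (f : R -> C) (t : R) (d : C) : Prop :=
  is_derive t 1 (Re \o f) (Re d) /\ is_derive t 1 (Im \o f) (Im d).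

Lemma ccontinuous_cst (z : C) : ccontinuous (fun=> z).
Proof. by split=> x; exact: cvg_cst. Qed.

Lemma ccontinuousD (f g : R -> C) :
  ccontinuous f -> ccontinuous g -> ccontinuous (fun t => f t + g t).
Proof.
move=> [f1 f2] [g1 g2]; split.
- rewrite (_ : _ \o _ = (fun t => Re (f t) + Re (g t))); last first.
    by apply/funext => t /=; rewrite Defs.ReD.
  by move=> x; apply: cvgD; [exact: f1|exact: g1].
- rewrite (_ : _ \o _ = (fun t => Im (f t) + Im (g t))); last first.
    by apply/funext => t /=; rewrite Defs.ImD.
  by move=> x; apply: cvgD; [exact: f2|exact: g2].
Qed.

Lemma ccontinuousM (f g : R -> C) :
  ccontinuous f -> ccontinuous g -> ccontinuous (fun t => f t * g t).
Proof.
move=> [f1 f2] [g1 g2]; split.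
- rewrite (_ : _ \o _ = (fun t => Re (f t) * Re (g t) - Im (f t) * Im (g t))); last first.
    by apply/funext => t /=; rewrite Defs.ReM.
  move=> x; apply: cvgB; apply: cvgM; [exact: f1|exact: g1|exact: f2|exact: g2].
- rewrite (_ : _ \o _ = (fun t => Im (f t) * Re (g t) + Re (f t) * Im (g t))); last first.
    by apply/funext => t /=; rewrite Defs.ImM.
  move=> x; apply: cvgD; apply: cvgM; [exact: f2|exact: g1|exact: f1|exact: g2].
Qed.

Lemma ccontinuous_sum (I : Type) (r : seq I) (P : pred I) (F : I -> R -> C) :
  (forall i, P i -> ccontinuous (F i)) ->
  ccontinuous (fun t => \sum_(i <- r | P i) F i t).
Proof.
move=> Fc; elim: r => [|i r IH].
  rewrite (_ : (fun t => _) = fun=> 0); first exact: ccontinuous_cst.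
  by apply/funext => t; rewrite big_nil.
case: (boolP (P i)) => Pi; last first.
  rewrite (_ : (fun t => _) = (fun t => \sum_(j <- r | P j) F j t))//.
  by apply/funext => t; rewrite big_cons (negPf Pi).
rewrite (_ : (fun t => _) = (fun t => F i t + \sum_(j <- r | P j) F j t)); last first.
  by apply/funext => t; rewrite big_cons Pi.
by apply: ccontinuousD => //; exact: Fc.
Qed.

Lemma cis_derive_ccontinuous (f df : R -> C) :
  (forall t, cis_derive f t (df t)) -> ccontinuous f.
Proof.
move=> fd; split=> t; apply/differentiable_continuous/derivable1_diffP.
- by have [[]] := fd t.
- by have [_ []] := fd t.
Qed.

Lemma cis_deriveM (f g : R -> C) (t : R) (df dg : C) :
  cis_derive f t df -> cis_derive g t dg ->
  cis_derive (fun t => f t * g t) t (df * g t + f t * dg).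
Proof.
move=> [f1 f2] [g1 g2]; split.
- rewrite (_ : _ \o _ = (Re \o f) * (Re \o g) - (Im \o f) * (Im \o g)); last first.
    by apply/funext => s /=; rewrite Defs.ReM.
  apply: (is_derive_eq (is_deriveB (is_deriveM f1 g1) (is_deriveM f2 g2))).
  by rewrite Defs.ReD !Defs.ReM /GRing.scale /=; ring.
- rewrite (_ : _ \o _ = (Im \o f) * (Re \o g) + (Re \o f) * (Im \o g)); last first.
    by apply/funext => s /=; rewrite Defs.ImM.
  apply: (is_derive_eq (is_deriveD (is_deriveM f2 g1) (is_deriveM f1 g2))).
  by rewrite Defs.ImD !Defs.ImM /GRing.scale /=; ring.
Qed.

Lemma cis_derive0_cst (f : R -> C) (s t : R) :
  (forall t, cis_derive f t 0) -> f s = f t.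
Proof.
move=> fd; apply/eqP; rewrite eq_complex; apply/andP; split; apply/eqP.
- by apply: (@is_derive_0_is_cst R (Re \o f)) => x; have [] := fd x.
- by apply: (@is_derive_0_is_cst R (Im \o f)) => x; have [] := fd x.
Qed.

Lemma cantiderivative (z : C) (g : R -> C) : ccontinuous g ->
  exists2 G, G 0 = z & forall t, cis_derive G t (g t).
Proof.
move=> [/antiderivative[G1 G10 G1d] /antiderivative[G2 G20 G2d]].
exists (fun t => (Re z + G1 t) +i* (Im z + G2 t)).
  by rewrite G10 G20 !addr0; case: z.
move=> t; split.
- by have := is_deriveD (is_derive_cst (Re z) t 1) (G1d t); rewrite add0r.
- by have := is_deriveD (is_derive_cst (Im z) t 1) (G2d t); rewrite add0r.
Qed.

Lemma expi0 : expi (0 : R) = 1.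
Proof. by rewrite /expi cos0 sin0. Qed.

Lemma expiD (x y : R) : expi (x + y) = expi x * expi y.
Proof.
by apply/eqP; rewrite eq_complex /= cosD sinD addrC eqxx/= addrC eqxx.
Qed.

Lemma normc_expi (x : R) : normc (expi x) = 1.
Proof. by rewrite /= cos2Dsin2 sqrtr1. Qed.

(** The complex exponential [exp (lam t)], the propagator of [f' = lam f]. *)
Definition cexp (lam : C) (t : R) : C :=
  (expR (Re lam * t))%:C * expi (Im lam * t).

Lemma cexp0 (lam : C) : cexp lam 0 = 1.
Proof. by rewrite /cexp !mulr0 expR0 expi0 mulr1. Qed.

Lemma cexp_0 (t : R) : cexp 0 t = 1.
Proof. by rewrite /cexp /= !mul0r expR0 expi0 mulr1. Qed.

Lemma cexpN (lam : C) (t : R) : cexp lam t * cexp (- lam) t = 1.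
Proof.
case: lam => a b; rewrite /cexp /= !mulNr mulrACA -expiD subrr expi0 mulr1.
by rewrite -rmorphM /= -expRD subrr expR0.
Qed.

Lemma normc_cexp (lam : C) (t : R) : normc (cexp lam t) = expR (Re lam * t).
Proof.
rewrite /cexp normcM normc_expi mulr1 /normc /= expr0n addr0 sqrtr_sqr.
by rewrite gtr0_norm// expR_gt0.
Qed.

Lemma cis_derive_cexp (lam : C) (t : R) :
  cis_derive (cexp lam) t (lam * cexp lam t).
Proof.
case: lam => a b.
have e : cis_derive (fun s => (expR (a * s))%:C) t (a * expR (a * t))%:C.
  split; last exact: is_derive_cst.
  apply: (is_derive_eq (is_derive1_comp (is_derive_expR (a * t)) (is_derive_lin a t))).
  by rewrite mulrC.
have c : cis_derive (fun s => expi (b * s)) t ((- b * sin (b * t)) +i* (b * cos (b * t))).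
  split; last exact: is_derive_sinl.
  by apply: (is_derive_eq (is_derive_cosl b t)); rewrite mulNr.
have := cis_deriveM e c; congr cis_derive.
apply/eqP; rewrite eq_complex Defs.ReD Defs.ImD !Defs.ReM !Defs.ImM /=.
by apply/andP; split; apply/eqP; ring.
Qed.

(** The product [cexp (- lam) t * f t] has zero derivative. *)
Lemma linear_ode_unique (lam : C) (f : R -> C) :
  (forall t, cis_derive f t (lam * f t)) -> forall t, f t = cexp lam t * f 0.
Proof.
move=> fd t.
have : cexp (- lam) t * f t = cexp (- lam) 0 * f 0.
  apply: (@cis_derive0_cst (fun t => cexp (- lam) t * f t)) => {}t.
  have := cis_deriveM (cis_derive_cexp (- lam) t) (fd t); congr cis_derive.
  by ring.
by rewrite cexp0 mul1r => <-; rewrite mulrA cexpN mul1r.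
Qed.

(** Variation of constants: [f = cexp lam * v] where [v' = cexp (- lam) * g]. *)
Lemma linear_ode_exists (lam z : C) (g : R -> C) : ccontinuous g ->
  exists2 f, f 0 = z & forall t, cis_derive f t (lam * f t + g t).
Proof.
move=> cg; have cE : ccontinuous (cexp (- lam)).
  exact: cis_derive_ccontinuous (cis_derive_cexp (- lam)).
have [v v0 vd] := cantiderivative z (ccontinuousM cE cg).
exists (fun t => cexp lam t * v t); first by rewrite cexp0 mul1r.
move=> t; have := cis_deriveM (cis_derive_cexp lam t) (vd t); congr cis_derive.
by rewrite -mulrA; congr (_ + _); rewrite mulrA cexpN mul1r.
Qed.

(** In a triangular system the equation for the mode [n] is linear in that mode,
    with a source [N n] depending on the modes below [n] only, so the modes can
    be found one after the other. *)
Lemma triangular_ode_exists (lam z : nat -> C) (N : nat -> (nat -> C) -> C) :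
  (forall n x y, (forall k, (k < n)%N -> x k = y k) -> N n x = N n y) ->
  (forall n (u : R -> nat -> C), (forall k, (k < n)%N -> ccontinuous (u ^~ k)) ->
    ccontinuous (fun t => N n (u t))) ->
  exists2 u : R -> nat -> C, (forall n, u 0 n = z n) &
    forall n t, cis_derive (u ^~ n) t (lam n * u t n + N n (u t)).
Proof.
move=> Ndep Ncont.
have /choice[sol solP] (p : C * C * (R -> C)) : exists f : R -> C, ccontinuous p.2 ->
    f 0 = p.1.2 /\ forall t, cis_derive f t (p.1.1 * f t + p.2 t).
  have [/(linear_ode_exists p.1.1 p.1.2)[f f0 fd]|nc] := pselect (ccontinuous p.2).
    by exists f.
  by exists (fun=> 0).
(* The table tab n holds the solutions for the modes below n. *)
pose fix tab n : R -> nat -> C := match n with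
  | 0 => fun _ _ => 0
  | m.+1 => fun t k => if k == m then sol (lam m, z m, fun s => N m (tab m s)) t
                       else tab m t k end.
pose u t n := tab n.+1 t n.
have tabE n t k : (k < n)%N -> tab n t k = u t k.
  elim: n k => // n IH k; rewrite ltnS leq_eqVlt => /predU1P[->//|kn].
  by rewrite /= ltn_eqF// IH.
have uE n : u ^~ n = sol (lam n, z n, fun s => N n (u s)).
  apply/funext => t; rewrite /u /= eqxx; congr sol; congr (_, _).
  by apply/funext => s; apply: Ndep => k kn; exact: tabE.
have uc n : ccontinuous (u ^~ n).
  elim/ltn_ind: n => n IH; rewrite uE.
  have := solP (lam n, z n, fun s => N n (u s)) (Ncont n u IH).
  by move=> [_ /cis_derive_ccontinuous].
exists u => n.
  have [+ _] := solP (lam n, z n, fun s => N n (u s)) (Ncont n u (fun k _ => uc k)).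
  by rewrite -uE.
have [_ +] := solP (lam n, z n, fun s => N n (u s)) (Ncont n u (fun k _ => uc k)).
by rewrite -uE.
Qed.

Lemma cis_derive_within (D : set R) (f : R -> C) (t : R) (d : C) :
  cis_derive f t d -> cderiv_within D f t d.
Proof.
have H (h : R -> R) (e : R) : is_derive t 1 h e -> rderiv_within D h t e.
  (* Off t the difference quotient is Caratheodory's continuous function g. *)
  move=> /is_derive1_caratheodory[g [hg cg <-]].
  apply: cvg_within_filter.
  have /continuous_withinNx := cg; apply: cvg_trans; apply: near_eq_cvg.
  near=> x; have xt : x != t by near: x; exact: nbhs_dnbhs_neq.
  by rewrite /= hg mulfK// subr_eq0.
by move=> [/H ? /H ?]; split.
Unshelve. all: by end_near. Qed.

Lemma C1_curve_lipschitz (f df : R -> C) (T : R) :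
  (forall t, cis_derive f t (df t)) -> ccontinuous df ->
  exists2 L, 0 <= L & forall s t, 0 <= s <= T -> 0 <= t <= T ->
    normc (f s - f t) <= L * `|s - t|.
Proof.
move=> fd [c1 c2].
have [L1 L10 h1] := C1_lipschitz T (fun t => (fd t).1) c1.
have [L2 L20 h2] := C1_lipschitz T (fun t => (fd t).2) c2.
exists (L1 + L2); first exact: addr_ge0.
move=> s t sT tT; rewrite mulrDl.
have E (x y : R) : normc (x +i* y) <= `|x| + `|y|.
  rewrite /= -[leRHS]ger0_norm ?addr_ge0// -sqrtr_sqr ler_wsqrtr// sqrrD.
  by rewrite !real_normK ?num_real// addrAC lerDl mulrn_wge0// mulr_ge0.
have := h1 s t sT tT; have := h2 s t sT tT => /=.
case: (f s) (f t) => [a b] [c d] /= H2 H1.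
by rewrite (le_trans (E _ _))// lerD.
Qed.

End ComplexCurves.

(** * The quadratic interaction *)

Section Interaction.
Context {R : realType}.
Local Notation C := R[i].

(** The part of the quadratic interaction at frequency [n] that does not involve
    the mean [x 0]; it only involves the modes [x k] with [0 < k < n]. *)
Definition source (beta : R) (n : nat) (x : nat -> C) : C :=
  \sum_(p : 'I_n.+1 * 'I_n.+1 | [&& (p.1 + p.2)%N == n, p.1 != ord0 & p.2 != ord0])
    x p.1 * (p.2%:R `^ beta)%:C * x p.2.

(** Pairs with [p.1 = 0] give the mean times the mode [n]; pairs with [p.2 = 0]
    contribute nothing because the derivative kills the mean. *)
Lemma interaction_split (beta : R) (n : nat) (x : nat -> C) : beta != 0 ->
  \sum_(p : 'I_n.+1 * 'I_n.+1 | (p.1 + p.2)%N == n)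
    x p.1 * (p.2%:R `^ beta)%:C * x p.2 =
  x 0%N * (n%:R `^ beta)%:C * x n + source beta n x.
Proof.
move=> b0; rewrite (bigID (fun p => p.1 == ord0)) /=; congr (_ + _).
  rewrite (big_pred1 (ord0, ord_max)) //= => -[p1 p2] /=.
  rewrite xpair_eqE -!val_eqE /= andbC.
  by case: (nat_of_ord p1 =P 0%N) => [->|//]; rewrite add0n.
rewrite (bigID (fun p : 'I_n.+1 * 'I_n.+1 => p.2 == ord0)) /= big1 ?add0r.
  by apply: eq_bigl => p; rewrite andbA.
move=> p /andP[_ /eqP ->] /=.
by rewrite powR0// mulr0 mul0r.
Qed.

Lemma source_lt (n : nat) (p : 'I_n.+1 * 'I_n.+1) :
  [&& (p.1 + p.2)%N == n, p.1 != ord0 & p.2 != ord0] ->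
  [/\ 0 < p.1, p.1 < n, 0 < p.2 & p.2 < n]%N.
Proof.
case: p => p1 p2 /= /and3P[/eqP pn]; rewrite -!val_eqE /= -!lt0n => h1 h2.
have l1 : (p1 < p1 + p2)%N by rewrite -[ltnLHS]addn0 ltn_add2l.
have l2 : (p2 < p1 + p2)%N by rewrite -[ltnLHS]add0n ltn_add2r.
split=> //; first by rewrite (leq_trans l1)// pn.
by rewrite (leq_trans l2)// pn.
Qed.

Lemma source_eq (beta : R) (n : nat) (x y : nat -> C) :
  (forall k, (k < n)%N -> x k = y k) -> source beta n x = source beta n y.
Proof.
by move=> xy; apply: eq_bigr => p /source_lt[_ h1 _ h2]; rewrite !xy.
Qed.

Lemma source_ccontinuous (beta : R) (n : nat) (u : R -> nat -> C) :
  (forall k, (k < n)%N -> ccontinuous (u ^~ k)) ->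
  ccontinuous (fun t => source beta n (u t)).
Proof.
move=> uc; apply: ccontinuous_sum => p /source_lt[_ h1 _ h2].
apply: ccontinuousM; last exact: uc.
by apply: ccontinuousM; [exact: uc|exact: ccontinuous_cst].
Qed.

(** When no mode strictly between [0] and [N] is excited, two nonzero modes can
    only interact into frequencies at least [2 N]. *)
Lemma source_eq0 (beta : R) (N n : nat) (x : nat -> C) : (n <= N)%N ->
  (forall k, (0 < k < N)%N -> x k = 0) -> source beta n x = 0.
Proof.
move=> nN x0; apply: big1 => p /source_lt[h0 h1 _ _].
by rewrite x0 ?mul0r// h0 (leq_trans h1).
Qed.

End Interaction.

(** * Exponential growth beats any Sobolev weight *)

Section FrequencyChoice.
Context {R : realType}.

(** Since [N ^ beta] is a positive power of [N] while the logarithm of a power of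
    the weight is [O (ln N)], the exponential growth factor wins. *)
Lemma frequency_exists (kappa beta y K : R) : 0 < beta -> 0 < y ->
  exists2 N : nat, (0 < N)%N &
    K < japanese (Posz N) `^ kappa * expR (y * N%:R `^ beta).
Proof.
move=> b0 y0; pose a := `|kappa|; have a0 : 0 <= a by exact: normr_ge0.
pose Q := a * (2 / beta) + a + `|K| + 1.
have a2b : 0 <= a * (2 / beta) by rewrite mulr_ge0// divr_ge0// ltW.
have Q0 : 0 < Q by have := normr_ge0 K; rewrite /Q; lra.
(* The exponent is at least y X ^ 2 - a (1 + 2 / beta X) with X = N ^ (beta / 2),
   and B is a value of X beyond which it exceeds K. *)
pose B := 1 + Q / y; have B1 : 1 < B by rewrite ltrDl divr_gt0.
pose N := (Num.truncn (B `^ (2 / beta))).+1; exists N => //.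
have N1 : (1 : R) <= N%:R by rewrite ler1n.
pose X := N%:R `^ (beta / 2); have BX : B <= X.
  have -> : B = (B `^ (2 / beta)) `^ (beta / 2).
    rewrite -powRrM mulf_div (mulrC beta) divff ?powRr1//; first lra.
    by rewrite mulf_neq0 ?gt_eqF.
  rewrite ge0_ler_powR ?nnegrE ?powR_ge0//; first by rewrite divr_ge0 ?ltW.
  by rewrite ltW// truncnS_gt.
have X0 : 0 < X by lra.
have NX : N%:R `^ beta = X ^+ 2.
  by rewrite /X -powR_mulrn ?powR_ge0// -powRrM divfK.
have lnN : ln N%:R <= (2 / beta) * X.
  have -> : ln N%:R = (2 / beta) * ln X.
    by rewrite /X ln_powR mulrA mulf_div (mulrC beta) divff ?mul1r// mulf_neq0 ?gt_eqF.
  by rewrite ler_pM2l ?divr_gt0// (le_trans (ltW (ln_sublinear _))).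
pose J := japanese (Posz N) : R.
have J0 : 1 <= J.
  rewrite -sqrtr1 ler_wsqrtr// lerDl sqr_ge0 //.
have lnJ0 : 0 <= ln J by rewrite ln_ge0.
have lnJ : ln J <= 1 + 2 / beta * X.
  have JN : J <= 2 * N%:R.
    rewrite -[leRHS]ger0_norm ?mulr_ge0// -sqrtr_sqr ler_wsqrtr//.
    have : (1 : R) <= N%:R ^+ 2 by exact: exprn_ege1.
    by rewrite exprMn -pmulrn; lra.
  have N0 : 0 < (N%:R : R) by lra.
  apply: (@le_trans _ _ (ln (2 * N%:R))); first by rewrite ler_ln ?posrE; lra.
  rewrite lnM ?posrE//; apply: lerD => //.
  by apply: (@le_ln1Dx R 1); lra.
rewrite NX -/J /powR (gt_eqF (lt_le_trans ltr01 J0)) -expRD; apply: (@lt_le_trans _ _ (1 + (- (a * (1 + 2 / beta * X)) + y * X ^+ 2))).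
  have E : 1 + (- (a * (1 + 2 / beta * X)) + y * X ^+ 2) =
     1 - a + X * (y * X - a * (2 / beta)) by ring.
  have h1 : a + `|K| + 1 <= y * X - a * (2 / beta).
    have : y * B <= y * X by rewrite ler_pM2l.
    have -> : y * B = y + Q by rewrite /B; field; rewrite gt_eqF.
    by rewrite /Q; lra.
  have h2 : a + `|K| + 1 <= X * (y * X - a * (2 / beta)).
    rewrite -[leLHS]mul1r ler_pM//; last lra.
    by have := normr_ge0 K; lra.
  by rewrite E; have := ler_norm K; lra.
apply: (le_trans (expR_ge1Dx _)); rewrite ler_expR lerD2r lerNl.
rewrite -mulNr (le_trans (ler_wpM2r lnJ0 (_ : - kappa <= a)))//.
  by rewrite /a -normrN ler_norm.
by rewrite ler_wpM2l.
Qed.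

End FrequencyChoice.

(** * The initial datum and its Sobolev norm *)

Section FourierCoefficients.
Context {R : realType}.
Local Notation C := R[i].
Notation leb := (@lebesgue_measure R).
Local Notation Re := (@complex.Re R).
Local Notation Im := (@complex.Im R).

Lemma expi_2piM (k : int) : expi (2 * pi * k%:~R) = 1 :> C.
Proof.
have e1 : expi (2 * pi) = 1 :> C by rewrite /expi mulr_natl cos2pi sin2pi.
have e (n : nat) : expi (2 * pi * n%:R) = 1 :> C.
  elim: n => [|n IH]; first by rewrite mulr0 expi0.
  by rewrite -[n.+1%:R]natr1 mulrDr mulr1 expiD IH e1 mulr1.
case: k => n; first exact: e.
rewrite NegzE mulrNz mulrN -pmulrn.
by have := expiD (2 * pi * n.+1%:R) (- (2 * pi * n.+1%:R) : R); rewrite subrr expi0 e mul1r.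
Qed.

Lemma pi2_gt0 : 0 < 2 * pi :> R.
Proof. by rewrite mulr_gt0// pi_gt0. Qed.

Lemma int_cos (k : int) :
  \int[leb]_(x in `[0, 2 * pi]) cos (k%:~R * x) = if k == 0 then 2 * pi else 0.
Proof.
have p0 := pi2_gt0.
case: eqP => [->|/eqP k0].
  transitivity (\int[leb]_(x in `[0, 2 * pi]) 1).
    by apply: eq_Rintegral => x _; rewrite mul0r cos0.
  by rewrite Rintegral_cst_itv ?ltW// subr0 mul1r.
have kR : k%:~R != 0 :> R by rewrite intr_eq0.
have D (x : R) : is_derive x 1 (fun s : R => k%:~R^-1 * sin (k%:~R * s)) (cos (k%:~R * x)).
  apply: (is_derive_eq (is_deriveZ (k%:~R^-1) (is_derive_sinl k%:~R x))).
  by rewrite /GRing.scale /= mulKf.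
rewrite (derivable_FTC2 p0 D (@continuous_cosl R _)) mulr0 sin0 mulr0 subr0.
have := congr1 Im (expi_2piM k); rewrite mulrC /= => ->.
by rewrite mulr0.
Qed.

Lemma int_sin (k : int) : \int[leb]_(x in `[0, 2 * pi]) sin (k%:~R * x) = 0.
Proof.
have p0 := pi2_gt0.
case: (eqVneq k 0) => [->|k0].
  transitivity (\int[leb]_(x in `[0, 2 * pi]) (0 : R)).
    by apply: eq_Rintegral => x _; rewrite mul0r sin0.
  by rewrite Rintegral_cst_itv ?ltW// mul0r.
have kR : k%:~R != 0 :> R by rewrite intr_eq0.
have D (x : R) : is_derive x 1 (fun s : R => - k%:~R^-1 * cos (k%:~R * s)) (sin (k%:~R * x)).
  apply: (is_derive_eq (is_deriveZ (- k%:~R^-1) (is_derive_cosl k%:~R x))).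
  by rewrite /GRing.scale /= mulrNN mulKf.
rewrite (derivable_FTC2 p0 D (@continuous_sinl R _)) mulr0 cos0.
have := congr1 Re (expi_2piM k); rewrite mulrC /= => ->.
by rewrite subrr.
Qed.

Definition two_mode (c d : R) (N : nat) (x : R) : C :=
  c%:C + d%:C * expi (N%:R * x).

Lemma fcoef_two_mode (c d : R) (N : nat) (n : int) : (0 < N)%N ->
  fcoef (two_mode c d N) n =
  if n == 0 then c%:C else if n == Posz N then d%:C else 0.
Proof.
move=> N0.
have int_lin (f g : R -> R) : continuous f -> continuous g ->
    \int[leb]_(x in `[0, 2 * pi]) (c * f x + d * g x) =
    c * \int[leb]_(x in `[0, 2 * pi]) f x + d * \int[leb]_(x in `[0, 2 * pi]) g x.
  move=> cf cg; have i1 := continuous_itv_integrable 0 (2 * pi) cf.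
  have i2 := continuous_itv_integrable 0 (2 * pi) cg.
  have mI : measurable (`[0, 2 * pi]%classic : set (measurableTypeR R)).
    exact: measurable_itv.
  rewrite RintegralD//; last 2 first.
  - by have := integrableZl mI c i1.
  - by have := integrableZl mI d i2.
  by rewrite !RintegralZl.
have E x : two_mode c d N x * expi (- (n%:~R * x)) =
    (c * cos ((- n)%:~R * x) + d * cos ((Posz N - n)%:~R * x)) +i*
    (c * sin ((- n)%:~R * x) + d * sin ((Posz N - n)%:~R * x)).
  rewrite /two_mode mulrDl -mulrA -expiD -mulrBl.
  rewrite [(N%:R : R)]pmulrn -intrB mulrNz mulNr.
  by apply/eqP; rewrite eq_complex /= !mul0r !subr0 !addr0 !eqxx.
rewrite /fcoef /cintegral.
under eq_Rintegral do rewrite E /=.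
under [X in _ +i* X]eq_Rintegral do rewrite E /=.
rewrite !int_lin; [|exact: continuous_sinl..|exact: continuous_cosl|exact: continuous_cosl].
rewrite !int_cos !int_sin !mulr0 addr0 oppr_eq0 subr_eq0 (eq_sym (Posz N)).
have p0 := pi2_gt0.
have pK (z : R) : (2 * pi)^-1%:C * (z * (2 * pi) +i* 0) = z%:C.
  apply/eqP; rewrite eq_complex /=; apply/andP; split; apply/eqP.
    by rewrite mul0r subr0 mulrCA mulVf ?mulr1// gt_eqF.
  by rewrite mulr0 mul0r addr0.
case: eqP => [->|_].
  rewrite ifN ?mulr0 ?addr0 ?pK//.
  by rewrite eq_sym eqz_nat -lt0n.
rewrite mulr0 add0r; case: eqP => [_|_]; first exact: pK.
by rewrite mulr0; have := pK 0; rewrite mul0r.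
Qed.

Lemma smooth_real_trig (k A B D : R) :
  smooth_real (fun x : R => A * cos (k * x) + B * sin (k * x) + D).
Proof.
(* Derivatives stay in the span of cos (k x), sin (k x) and 1. *)
have dtrig (a b c x : R) : is_derive x 1 (fun x : R => a * cos (k * x) + b * sin (k * x) + c)
    (k * b * cos (k * x) + - (k * a) * sin (k * x) + 0).
  have h1 := is_deriveZ a (is_derive_cosl k x); have h2 := is_deriveZ b (is_derive_sinl k x).
  apply: (is_derive_eq (is_deriveD (is_deriveD h1 h2) (is_derive_cst c x 1))).
  by rewrite /GRing.scale /=; ring.
have E n : exists A' B' D', derive1n n (fun x : R => A * cos (k * x) + B * sin (k * x) + D) =
    (fun x : R => A' * cos (k * x) + B' * sin (k * x) + D').
  elim: n => [|n [A' [B' [D' IH]]]]; first by exists A, B, D.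
  exists (k * B'), (- (k * A')), 0; apply/funext => x.
  rewrite [LHS]/= IH derive1E.
  by have [_ ->] := dtrig A' B' D' x.
move=> n x; have [A' [B' [D' ->]]] := E n.
by have [] := dtrig A' B' D' x.
Qed.

Lemma two_mode_smooth_torus (c d : R) (N : nat) : smooth_torus (two_mode c d N).
Proof.
split; last first.
  move=> x; rewrite /two_mode mulrDr expiD [N%:R * (2 * pi)]mulrC.
  by rewrite [N%:R in X in _ * (_ * X)]pmulrn expi_2piM mulr1.
split.
- rewrite (_ : _ \o _ = (fun x : R => d * cos (N%:R * x) + 0 * sin (N%:R * x) + c)).
    exact: smooth_real_trig.
  by apply/funext => x /=; rewrite !mul0r subr0 addr0 addrC.
- rewrite (_ : _ \o _ = (fun x : R => 0 * cos (N%:R * x) + d * sin (N%:R * x) + 0)).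
    exact: smooth_real_trig.
  by apply/funext => x /=; rewrite !mul0r !add0r !addr0.
Qed.

Lemma Hnorm_two_modes (s x y : R) (N : nat) (a : int -> C) : (0 < N)%N ->
  (forall n, a n = if n == 0 then x%:C else if n == Posz N then y%:C else 0) ->
  Hnorm s a = (Num.sqrt (x ^+ 2 + (japanese (Posz N) `^ s * y) ^+ 2))%:E.
Proof.
move=> N0 aE; rewrite /Hnorm.
pose g (n : int) : \bar R := ((japanese n `^ s * normc (a n)) ^+ 2)%:E.
have nC (z : R) : normc z%:C = `|z| by rewrite /= expr0n addr0 sqrtr_sqr.
have sq (z w : R) : (z * `|w|) ^+ 2 = (z * w) ^+ 2.
  by rewrite !exprMn real_normK// num_real.
have -> : \esum_(n in [set: int]) g n = \esum_(n in [set 0; Posz N]) g n.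
  rewrite [RHS]esum_mkcond; apply: eq_esum => n _; case: ifPn => // /negP.
  rewrite inE /= /g aE => nn; case: eqP => [n0|_]; first by exfalso; apply: nn; left.
  case: eqP => [n0|_]; first by exfalso; apply: nn; right.
  by rewrite nC normr0 mulr0 expr0n.
rewrite esum_fset; [|exact: finite_set2|by move=> n _; rewrite lee_fin sqr_ge0].
rewrite fsbigU//=; last first.
  by move=> n [/= -> /eqP]; rewrite eq_sym eqz_nat eqn0Ngt N0.
rewrite !fsbig_set1 /g !aE eqxx ifN; last by rewrite eqz_nat -lt0n.
rewrite eqxx !nC !sq /japanese expr0n addr0 sqrtr1 powR1 mul1r.
by rewrite -EFinD poweR_EFin powR12_sqrt// addr_ge0// sqr_ge0.
Qed.

Lemma Hnorm_ge_mode (s : R) (a : int -> C) (n : int) :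
  ((japanese n `^ s * normc (a n))%:E <= Hnorm s a)%E.
Proof.
have h0 : 0 <= japanese n `^ s * normc (a n) by rewrite mulr_ge0 ?powR_ge0 ?normc_ge0.
have -> : (japanese n `^ s * normc (a n))%:E =
    (((japanese n `^ s * normc (a n)) ^+ 2)%:E `^ 2^-1)%E.
  by rewrite poweR_EFin powR12_sqrt ?sqr_ge0// sqrtr_sqr ger0_norm.
have es0 : (0 <= \esum_(i in [set: int]) ((japanese i `^ s * normc (a i)) ^+ 2)%:E)%E.
  by apply: esum_ge0 => i _; rewrite lee_fin sqr_ge0.
apply: gt0_ler_poweR; rewrite ?in_itv/= ?leey ?lee_fin ?invr_ge0 ?sqr_ge0 ?es0//.
apply: esum_ge; exists [set n]; last by rewrite fsbig_set1.
by split=> //; exact: finite_set1.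
Qed.

End FourierCoefficients.

(** * Norm inflation *)

Section TwoModeSolution.
Context {R : realType}.
Local Notation C := R[i].
Local Notation Re := (@complex.Re R).

(** Linearizing about the constant [c], the mode [n] is multiplied by the
    exponential of this rate; its real part [c n ^ beta] is the source of the
    growth. *)
Definition growth_rate (alpha beta c : R) (n : nat) : C :=
  - ((0 +i* 1) * (n%:R `^ alpha)%:C) + c%:C * (n%:R `^ beta)%:C.

Lemma Re_growth_rate (alpha beta c : R) (n : nat) :
  Re (growth_rate alpha beta c n) = c * n%:R `^ beta.
Proof. by rewrite /growth_rate /=; ring. Qed.

(** The mean [c] is conserved, so the linear part of the equation for the mode [n]
    has the constant rate [growth_rate n]. The modes strictly between [0] and [N]
    start from 0 and have no source, hence stay 0; consequently the mode [N] has
    no source either and evolves by a pure exponential. *)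
Lemma two_mode_solution (alpha beta c d : R) (N : nat) (z : nat -> C) :
  0 < alpha -> 0 < beta -> (0 < N)%N ->
  (forall n, z n = if n == 0%N then c%:C else if n == N then d%:C else 0) ->
  exists u : R -> nat -> C, exists f : R -> nat -> C,
  [/\ forall n, u 0 n = z n,
      forall t, u t 0%N = c%:C,
      forall n, ccontinuous (f ^~ n),
      forall n t, cis_derive (u ^~ n) t (f t n) &
      (forall n t, f t n + (0 +i* 1) * (n%:R `^ alpha)%:C * u t n =
        \sum_(p : 'I_n.+1 * 'I_n.+1 | (p.1 + p.2)%N == n)
          u t p.1 * (p.2%:R `^ beta)%:C * u t p.2) /\
      forall t, u t N = cexp (growth_rate alpha beta c N) t * d%:C].
Proof.
move=> a0 b0 N0 zE.
have [u u0 ud] := triangular_ode_exists (growth_rate alpha beta c) z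
  (@source_eq _ beta) (@source_ccontinuous _ beta).
have uc n : ccontinuous (u ^~ n) := cis_derive_ccontinuous (ud n).
have umean t : u t 0%N = c%:C.
  have S s : source beta 0 (u s) = 0.
    by apply: (@source_eq0 _ _ 0) => // k; rewrite ltn0 andbF.
  have g0 : growth_rate alpha beta c 0 = 0.
    by rewrite /growth_rate !powR0 ?gt_eqF// !mulr0 oppr0 addr0.
  rewrite (@linear_ode_unique _ 0 (u ^~ 0%N)); last first.
    by move=> s; have := ud 0%N s; rewrite g0 S addr0.
  by rewrite cexp_0 mul1r u0 zE.
have ulow t n : (0 < n < N)%N -> u t n = 0.
  elim/ltn_ind: n t => n IH t /andP[n0 nN].
  rewrite (@linear_ode_unique _ (growth_rate alpha beta c n) (u ^~ n)).
    by rewrite u0 zE gtn_eqF// ltn_eqF// mulr0.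
  move=> s; have := ud n s; rewrite (@source_eq0 _ _ n) ?addr0// => k /andP[k0 kn].
  by apply: IH; rewrite ?kn// k0 (ltn_trans kn).
exists u, (fun t n => growth_rate alpha beta c n * u t n + source beta n (u t)).
split=> //.
- move=> n; apply: ccontinuousD.
    by apply: ccontinuousM; [exact: ccontinuous_cst|exact: uc].
  by apply: source_ccontinuous => k _; exact: uc.
- split=> [n t|t].
    rewrite interaction_split ?gt_eqF// umean /growth_rate.
    by ring.
  rewrite (@linear_ode_unique _ (growth_rate alpha beta c N) (u ^~ N)).
    by rewrite u0 zE eqxx gtn_eqF.
  by move=> s; have := ud N s; rewrite (@source_eq0 _ _ N) ?addr0// => k; exact: ulow.
Qed.

End TwoModeSolution.

Theorem theorem1p4 (R : realType) (alpha beta s sigma : R)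
    (alpha_gt0 : 0 < alpha) (beta_gt0 : 0 < beta) :
  exists2 eps0 : R, 0 < eps0 & forall eps : R, 0 < eps < eps0 ->
  exists (phi : R -> R[i]) (T : R) (u : R -> fdist R) (uh : R -> nat -> R[i]),
    [/\ smooth_torus phi,
        (Hnorm s (fcoef phi) < eps%:E)%E,
        (forall n : int, n < 0 -> fcoef phi n = 0) &
        0 < T < eps] /\
    (forall t : R, 0 <= t <= T -> has_coefs (u t) (uh t)) /\
    [/\ exists (k : fdist R) (w : R -> FXspace R),
          [/\ is_constant k (fcoef phi 0),
              (forall t : R, 0 <= t <= T -> (w t : fdist R) = u t - k) &
              {within `[0, T], continuous w}],
        (forall (t : R) (n : nat), 0 <= t <= T ->
          exists2 d : R[i], cderiv_within `[0, T] (uh ^~ n) t d &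
            d + (0 +i* 1) * (n%:R `^ alpha)%:C * uh t n =
            \sum_(p : 'I_n.+1 * 'I_n.+1 | (p.1 + p.2)%N == n)
              uh t p.1 * (p.2%:R `^ beta)%:C * uh t p.2) /\
        (forall n : nat, uh 0 n = fcoef phi n) &
        (Hnorm sigma (extend0 (uh T)) > (eps^-1)%:E)%E].
Proof.
exists 1 => // eps /andP[e0 _].
have y0 : 0 < eps / 2 * (eps / 2) by rewrite mulr_gt0 ?divr_gt0.
have [N N0 hN] := frequency_exists (sigma - s) (2 / eps ^+ 2) beta_gt0 y0.
pose J : R := japanese (Posz N).
have J0 : 0 < J by rewrite sqrtr_gt0 ltr_wpDr// sqr_ge0.
(* The amplitude d makes d e^{iNx} of norm eps / 2 in H^s, whatever s is. *)
pose c := eps / 2; pose d := J `^ (- s) * (eps / 2).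
have d0 : 0 <= d by rewrite mulr_ge0 ?powR_ge0// divr_ge0// ltW.
have Jsd : J `^ s * d = eps / 2.
  by rewrite /d mulrA powRN mulfV ?mul1r// gt_eqF ?powR_gt0.
pose phi := two_mode c d N.
have phiE n : fcoef phi n = if n == 0 then c%:C else if n == Posz N then d%:C else 0.
  exact: fcoef_two_mode.
have [u [f [u0 umean fc ud [ueq uN]]]] :=
  @two_mode_solution R alpha beta c d N (fun n => fcoef phi (Posz n))
    alpha_gt0 beta_gt0 N0 (fun n => phiE (Posz n)).
exists phi, (eps / 2), (fun t => fcomb (u t)), u; split; last split.
- split; first exact: two_mode_smooth_torus.
  + rewrite (Hnorm_two_modes s N0 phiE) -/J Jsd lte_fin.
    rewrite -[ltRHS]gtr0_norm// -sqrtr_sqr ltr_sqrt; last by rewrite exprn_gt0.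
    have := y0; rewrite /c expr_div_n expr2; lra.
  + by case=> n // _; rewrite phiE.
  + by apply/andP; split; lra.
- by move=> t _; exact: fcomb_coefs.
- pose k n := if n == 0%N then fcoef phi 0 else 0.
  split.
  + pose v t n := u t n - k n.
    have v0 t : v t 0%N = 0 by rewrite /v umean /k /= phiE subrr.
    exists (fcomb k), (fun t => @fxcomb R (v t) (v0 t)); split.
    * exact: fcomb_coefs.
    * by move=> t _; exact: (fcombB (u t) k).
    * have /choice[L hL] n : exists L : R, 0 <= L /\ forall x t, 0 <= x <= eps / 2 ->
          0 <= t <= eps / 2 -> normc (u x n - u t n) <= L * `|x - t|.
        have [L L0 hL] := C1_curve_lipschitz (eps / 2) (ud n) (fc n).
        by exists L.
      apply: (@fxcomb_continuous R _ v L v0) => [n|n x t xT tT]; first by have [] := hL n.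
      have [_ h] := hL n; have := h x t xT tT; congr (normc _ <= _); rewrite /v; ring.
  + split=> // t n _; exists (f t n); last exact: ueq.
    exact: cis_derive_within.
  + apply: lt_le_trans (Hnorm_ge_mode sigma _ (Posz N)).
    have nd : normc d%:C = d by rewrite /= expr0n addr0 sqrtr_sqr ger0_norm.
    rewrite lte_fin (_ : extend0 _ _ = u (eps / 2) N) // uN normcM normc_cexp Re_growth_rate -/J nd.
    have -> : J `^ sigma * (expR (c * N%:R `^ beta * (eps / 2)) * d) =
        J `^ (sigma - s) * expR (eps / 2 * (eps / 2) * N%:R `^ beta) * (eps / 2).
      rewrite powRD; last by rewrite (gt_eqF J0) implybT.
      rewrite /d (_ : c * _ * _ = eps / 2 * (eps / 2) * N%:R `^ beta).
        by ring.
      by rewrite /c; ring.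
    have -> : eps^-1 = 2 / eps ^+ 2 * (eps / 2) by field; rewrite gt_eqF.
    by rewrite ltr_pM2r// divr_gt0.
Qed.
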